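(* Let $n\ge1$ be an integer and $\beta>1$. The $\mathcal{M}_n(\beta)$-radius of functions in $\mathcal{S}_n$ is given by $$R_{\mathcal{M}_n(\beta)}(\mathcal{S}_n)=\left[\frac{\beta-1}{n+\sqrt{n^2+(\beta-1)^2}}\right]^{1/n}.$$
   Context: $\mathbb{D}=\{z\in\mathbb{C}:|z|<1\}$, $\mathbb{D}_r=\{z\in\mathbb{C}:|z|<r\}$. For an integer $n\ge1$, $\mathcal{A}_n$ is the class of analytic functions on $\mathbb{D}$ of the form $f(z)=z+\sum_{k\ge n+1}a_kz^k$. $\mathcal{P}_n$ is the class of analytic functions $p(z)=1+c_nz^n+c_{n+1}z^{n+1}+\cdots$ on $\mathbb{D}$ with $\operatorname{Re}p(z)>0$ for all $z\in\mathbb{D}$. $\mathcal{S}_n:=\{f\in\mathcal{A}_n: f(z)/z\in\mathcal{P}_n\}$. For $\beta>1$, $\mathcal{M}_n(\beta)$ is the class of $f\in\mathcal{A}_n$ with $\operatorname{Re}\left(zf'(z)/f(z)\right)<\beta$ for all $z\in\mathbb{D}$ (with $zf'(z)/f(z)$ taken to be $1$ at $z=0$). For a class $\mathcal{M}\subset\mathcal{A}_n$, the $\mathcal{M}_n(\beta)$-radius $R_{\mathcal{M}_n(\beta)}(\mathcal{M})$ is the largest number $R\in(0,1]$ such that for every $f\in\mathcal{M}$ and every $r<R$ one has $\operatorname{Re}\left(zf'(z)/f(z)\right)<\beta$ for all $z\in\mathbb{D}_r$. *)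

(* Defs.v *)
From Stdlib Require Import Reals.
From Coquelicot Require Import Coquelicot.

Open Scope R_scope.

Definition disc (r : R) (z : C) : Prop := Cmod z < r.

(* Functions are total on [C]; only their values on the unit disc matter. *)
Definition analytic_on_unit_disc (f : C -> C) : Prop :=
  forall z : C, disc 1 z -> @ex_derive C_AbsRing C_NormedModule f z.

Definition has_expansion (f : C -> C) (a : nat -> C) : Prop :=
  forall z : C, disc 1 z -> @is_pseries C_AbsRing C_NormedModule a z (f z).

Definition class_A (n : nat) (f : C -> C) : Prop :=
  analytic_on_unit_disc f /\
  exists a : nat -> C,
    a 0%nat = 0%C /\ a 1%nat = 1%C /\
    (forall k : nat, (2 <= k <= n)%nat -> a k = 0%C) /\
    has_expansion f a.

Definition class_P (n : nat) (p : C -> C) : Prop :=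
  analytic_on_unit_disc p /\
  (exists c : nat -> C,
    c 0%nat = 1%C /\
    (forall k : nat, (1 <= k < n)%nat -> c k = 0%C) /\
    has_expansion p c) /\
  (forall z : C, disc 1 z -> 0 < Re (p z)).

(* [f(z)/z], with the removable singularity at the origin filled in by
   its value [f'(0) = 1] for a normalized [f]. *)
Definition quotient_by_z (f : C -> C) (z : C) : C :=
  if Ceq_dec z 0%C then 1%C else (f z / z)%C.

Definition class_S (n : nat) (f : C -> C) : Prop :=
  class_A n f /\ class_P n (quotient_by_z f).

Definition z_log_derivative (f : C -> C) (z : C) : C :=
  if Ceq_dec z 0%C then 1%C else (z * C_derive f z / f z)%C.

(* Division is total in Coquelicot, so [f z <> 0] is what makes the quotient
   [z f'(z) / f(z)] meaningful away from the origin. *)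
Definition M_condition (beta r : R) (f : C -> C) : Prop :=
  forall z : C, disc r z ->
    (z <> 0%C -> f z <> 0%C) /\ Re (z_log_derivative f z) < beta.

Definition M_condition_below (beta : R) (F : (C -> C) -> Prop) (rho : R) : Prop :=
  0 < rho <= 1 /\
  forall f : C -> C, F f -> forall r : R, r < rho -> M_condition beta r f.

Definition is_M_radius (beta : R) (F : (C -> C) -> Prop) (rho : R) : Prop :=
  M_condition_below beta F rho /\
  forall rho' : R, M_condition_below beta F rho' -> rho' <= rho.

(* Main.v *)
Require Import Defs.
From Stdlib Require Import Reals Lra Lia.
From Coquelicot Require Import Coquelicot.

Open Scope R_scope.

(** Write [f = z * p] with [p] in the class [class_P n], so that
    [z * f' / f = 1 + z * p' / p].  The whole matter is the estimate
    [Re (z * p' / p) <= 2 * n * r ^ n / (1 - r ^ (2 n))] for [Cmod z = r]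
    ([log_derivative_bound]).  Its right side increases with [r] and equals
    [beta - 1] at the asserted radius; the function
    [z * (1 + z ^ n) / (1 - z ^ n)] gives equality there, so the radius cannot be
    larger.

    The estimate is proved by positivity of kernels, from the power series of [p]
    alone.  If two power series have nonnegative real part on the unit circle,
    averaging the product of the real parts over roots of unity shows that
    their Hadamard product has a real part bounded below by a constant term
    ([cpoly_positive_product], [series_positive_product]).  With the Poisson kernel
    as one factor, inequalities between values of the kernel become inequalities
    between values of any [g] with [Re g >= 0] on a circle ([poisson_comparison]).
    One of them, the monotonicity of [(1 + t r) / (1 - t r) * Re g (t z)] in [t],
    yields by differentiation the infinitesimal Harnack inequality
    [Re (z * g') + 2 r / (1 - r ^ 2) * Re g >= 0] ([harnack_derivative]), where [r]
    is the ratio of [Cmod z] to the radius of the circle.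

    For [g = p] this is the case [n = 1].  For general [n] the inequality is
    applied to [2 p - w (p + 1) - (p - 1) / w] with [w = a * z ^ n] ([twist]).
    It is analytic because [p - 1] vanishes to order [n] at the origin, and on the
    circle where [Cmod w = 1] its real part is [Re p * Cmod (1 - w) ^ 2 >= 0].
    The phase of [a] is free.  Harnack's inequality for the twist bounds
    [Re (e * z * p')] by a multiple of [Re p], for a unimodular number [e] that depends
    on this phase ([twisted_derivative_bound]), and the phase is chosen to
    give [e = Cmod p / p]. *)

(** * Complex derivatives *)

Definition is_Cderive (f : C -> C) (z l : C) : Prop :=
  @is_derive C_AbsRing C_NormedModule f z l.

Lemma is_Cderive_eps (f : C -> C) (z l : C) :
  is_Cderive f z l <->
  forall eps : posreal, exists delta : posreal, forall x : C,
    Cmod (x - z) < delta ->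
    Cmod (f x - f z - (x - z) * l) <= eps * Cmod (x - z).
Proof.
  split.
  - intros [_ Hd] eps.
    destruct (Hd z (fun P H => H) eps) as [delta Hdelta].
    exists delta; intros x Hx; exact (Hdelta x Hx).
  - intros H; split.
    + exact (is_linear_scal_l (K := C_AbsRing) (V := C_NormedModule) l).
    + intros x Hx eps.
      rewrite <- (is_filter_lim_locally_unique
                    (K := C_AbsRing) (V := AbsRing_NormedModule C_AbsRing) z x Hx).
      destruct (H eps) as [delta Hdelta].
      exists delta; intros y Hy; exact (Hdelta y Hy).
Qed.

Lemma is_Cderive_Cinv (z : C) : z <> 0%C -> is_Cderive Cinv z (- / (z * z))%C.
Proof.
  intros Hz. apply is_Cderive_eps; intros eps.
  pose proof (proj1 (Cmod_gt_0 z) Hz) as Hm.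
  set (m := Cmod z) in *.
  assert (Hd : 0 < Rmin (m / 2) (eps * (m * m * m) / 2)).
  { apply Rmin_pos; [lra |]. pose proof (cond_pos eps).
    assert (0 < m * m * m) by (repeat apply Rmult_lt_0_compat; lra).
    apply Rdiv_lt_0_compat; [apply Rmult_lt_0_compat | ]; lra. }
  exists (mkposreal _ Hd); simpl; intros x Hx.
  pose proof (Rlt_le_trans _ _ _ Hx (Rmin_l _ _)) as H1.
  pose proof (Rlt_le_trans _ _ _ Hx (Rmin_r _ _)) as H2.
  assert (Hxm : m / 2 < Cmod x).
  { pose proof (Cmod_triangle x (z - x)) as Ht.
    replace (x + (z - x))%C with z in Ht by ring.
    replace (z - x)%C with (- (x - z))%C in Ht by ring.
    rewrite Cmod_opp in Ht. fold m in Ht. lra. }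
  assert (Hx0 : x <> 0%C) by (apply Cmod_gt_0; lra).
  replace (/ x - / z - (x - z) * - / (z * z))%C
    with ((x - z) * ((x - z) / (x * (z * z))))%C by (field; auto).
  rewrite Cmod_mult, (Rmult_comm eps).
  apply Rmult_le_compat_l; [apply Cmod_ge_0 |].
  rewrite Cmod_div by (repeat apply Cmult_neq_0; auto).
  rewrite !Cmod_mult. fold m.
  apply Rle_div_l; [ repeat apply Rmult_lt_0_compat; lra |].
  assert (0 <= eps * (m * m) * (Cmod x - m / 2)).
  { pose proof (cond_pos eps). repeat apply Rmult_le_pos; lra. }
  lra.
Qed.


(** [C] carries two normed module structures over itself, with different uniform
    structures but the same norm.  The product and chain rules are stated for
    the one coming from the absolute ring, so derivatives are moved across. *)
Lemma is_Cderive_AbsRing (f : C -> C) (z l : C) :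
  is_Cderive f z l <->
  @is_derive C_AbsRing (AbsRing_NormedModule C_AbsRing) f z l.
Proof.
  split; intros [_ Hd]; (split; [| exact Hd]).
  - exact (is_linear_scal_l (K := C_AbsRing) (V := AbsRing_NormedModule C_AbsRing) l).
  - exact (is_linear_scal_l (K := C_AbsRing) (V := C_NormedModule) l).
Qed.

Lemma is_Cderive_mult (f g : C -> C) (z df dg : C) :
  is_Cderive f z df -> is_Cderive g z dg ->
  is_Cderive (fun x => f x * g x)%C z (df * g z + f z * dg)%C.
Proof.
  rewrite !is_Cderive_AbsRing; intros Hf Hg.
  exact (is_derive_mult (K := C_AbsRing) f g z df dg Hf Hg Cmult_comm).
Qed.

Lemma is_Cderive_comp (f g : C -> C) (z df dg : C) :
  is_Cderive f (g z) df -> is_Cderive g z dg ->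
  is_Cderive (fun x => f (g x)) z (df * dg)%C.
Proof.
  rewrite (is_Cderive_AbsRing g); intros Hf Hg.
  rewrite Cmult_comm.
  exact (is_derive_comp (K := C_AbsRing) (V := C_NormedModule) f g z df dg Hf Hg).
Qed.

Lemma is_Cderive_plus (f g : C -> C) (z df dg : C) :
  is_Cderive f z df -> is_Cderive g z dg ->
  is_Cderive (fun x => f x + g x)%C z (df + dg)%C.
Proof. exact (is_derive_plus (K := C_AbsRing) (V := C_NormedModule) f g z df dg). Qed.

Lemma is_Cderive_minus (f g : C -> C) (z df dg : C) :
  is_Cderive f z df -> is_Cderive g z dg ->
  is_Cderive (fun x => f x - g x)%C z (df - dg)%C.
Proof. exact (is_derive_minus (K := C_AbsRing) (V := C_NormedModule) f g z df dg). Qed.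

Lemma is_Cderive_const (c z : C) : is_Cderive (fun _ => c) z 0%C.
Proof. exact (is_derive_const (K := C_AbsRing) (V := C_NormedModule) c z). Qed.

Lemma is_Cderive_id (z : C) : is_Cderive (fun x => x) z 1%C.
Proof. apply is_Cderive_AbsRing. exact (is_derive_id (K := C_AbsRing) z). Qed.

Lemma is_Cderive_pow (n : nat) (z : C) :
  is_Cderive (fun x => x ^ n)%C z (INR n * z ^ (n - 1))%C.
Proof.
  induction n as [|n IH].
  - replace (INR 0 * z ^ (0 - 1))%C with (RtoC 0) by (simpl; ring).
    exact (is_Cderive_const 1 z).
  - replace (INR (S n) * z ^ (S n - 1))%C
      with (1 * z ^ n + z * (INR n * z ^ (n - 1)))%C.
    + exact (is_Cderive_mult _ _ z _ _ (is_Cderive_id z) IH).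
    + rewrite S_INR, RtoC_plus. replace (S n - 1)%nat with n by lia.
      destruct n as [|n]; [simpl; ring |].
      replace (S n - 1)%nat with n by lia. rewrite Cpow_S. ring.
Qed.

Lemma is_Cderive_div (f g : C -> C) (z df dg : C) :
  g z <> 0%C -> is_Cderive f z df -> is_Cderive g z dg ->
  is_Cderive (fun x => f x / g x)%C z ((df * g z - f z * dg) / (g z * g z))%C.
Proof.
  intros H0 Hf Hg.
  replace ((df * g z - f z * dg) / (g z * g z))%C
    with (df * / g z + f z * (- / (g z * g z) * dg))%C by (field; auto).
  apply (is_Cderive_mult f (fun x => / g x)%C); [exact Hf |].
  apply (is_Cderive_comp Cinv g); [| exact Hg].
  apply is_Cderive_Cinv, H0.
Qed.

(** Turns a complex derivative into a real one, so that monotonicity in the radius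
    can be differentiated. *)
Lemma is_derive_Re_ray (g : C -> C) (z l : C) :
  z <> 0%C -> is_Cderive g z l ->
  is_derive (fun t : R => Re (g (t * z)%C)) 1 (Re (z * l)).
Proof.
  intros Hz Hg.
  apply is_derive_Reals. intros eps Heps.
  pose proof (proj1 (Cmod_gt_0 z) Hz) as Hm.
  assert (He : 0 < eps / (2 * Cmod z)) by (apply Rdiv_lt_0_compat; lra).
  destruct (proj1 (is_Cderive_eps g z l) Hg (mkposreal _ He)) as [d Hd].
  simpl in Hd.
  assert (Hdd : 0 < d / Cmod z) by (apply Rdiv_lt_0_compat; [apply cond_pos | lra]).
  exists (mkposreal _ Hdd); intros h Hh0 Hh; simpl in Hh.
  assert (Hx : ((1 + h)%R * z - z = h * z)%C) by (rewrite RtoC_plus; ring).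
  specialize (Hd ((1 + h)%R * z)%C). rewrite Hx in Hd.
  rewrite Cmod_mult, Cmod_R in Hd.
  apply Rlt_div_r in Hh; [| lra].
  specialize (Hd Hh). rewrite Cmult_1_l.
  replace ((Re (g ((1 + h)%R * z)%C) - Re (g z)) / h - Re (z * l))
    with (Re (g ((1 + h)%R * z)%C - g z - h * z * l) / h).
  2: { unfold Cminus. rewrite !re_plus, !re_opp, <- Cmult_assoc, re_scal_l. field; auto. }
  rewrite Rabs_div by exact Hh0.
  pose proof (Rabs_pos_lt h Hh0) as Hhp.
  apply Rlt_div_l; [lra |].
  eapply Rle_lt_trans; [apply re_le_Cmod |].
  eapply Rle_lt_trans; [exact Hd |].
  replace (eps / (2 * Cmod z) * (Rabs h * Cmod z)) with (eps * Rabs h / 2) by (field; lra).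
  assert (0 < eps * Rabs h) by (apply Rmult_lt_0_compat; lra). lra.
Qed.

(** * Positivity for polynomials on the unit circle *)

Definition csum : (nat -> C) -> nat -> C := @sum_n C_AbelianMonoid.

Lemma csum_S (a : nat -> C) (n : nat) : csum a (S n) = (csum a n + a (S n))%C.
Proof. exact (sum_Sn a n). Qed.

Lemma csum_0 (a : nat -> C) : csum a 0 = a 0%nat.
Proof. exact (sum_O a). Qed.

Lemma csum_ext (a b : nat -> C) (n : nat) :
  (forall k, (k <= n)%nat -> a k = b k) -> csum a n = csum b n.
Proof. exact (sum_n_ext_loc (G := C_AbelianMonoid) a b n). Qed.

Lemma csum_mult_l (c : C) (a : nat -> C) (n : nat) :
  (c * csum a n)%C = csum (fun k => c * a k)%C n.
Proof. symmetry; exact (sum_n_mult_l (K := C_Ring) c a n). Qed.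

Lemma csum_mult_r (c : C) (a : nat -> C) (n : nat) :
  (csum a n * c)%C = csum (fun k => a k * c)%C n.
Proof. symmetry; exact (sum_n_mult_r (K := C_Ring) c a n). Qed.

Lemma csum_swap (a : nat -> nat -> C) (m n : nat) :
  csum (fun i => csum (a i) n) m = csum (fun j => csum (fun i => a i j) m) n.
Proof. exact (sum_n_switch (G := C_AbelianMonoid) a m n). Qed.

Lemma Re_csum (a : nat -> C) (n : nat) : Re (csum a n) = sum_n (fun k => Re (a k)) n.
Proof.
  induction n as [|n IH].
  - rewrite csum_0, sum_O. reflexivity.
  - rewrite csum_S, sum_Sn, re_plus, IH. reflexivity.
Qed.

Lemma Cconj_csum (a : nat -> C) (n : nat) :
  Cconj (csum a n) = csum (fun k => Cconj (a k)) n.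
Proof.
  induction n as [|n IH].
  - rewrite !csum_0. reflexivity.
  - rewrite !csum_S, Cplus_conj, IH. reflexivity.
Qed.

Lemma csum_single (a : nat -> C) (n i : nat) :
  (i <= n)%nat -> (forall k, (k <= n)%nat -> k <> i -> a k = 0%C) -> csum a n = a i.
Proof.
  assert (Hz : forall m, (forall k, (k <= m)%nat -> a k = 0%C) -> csum a m = 0%C).
  { induction m as [|m IH]; intros H.
    - rewrite csum_0; apply H; lia.
    - rewrite csum_S, IH, H by (intros; try apply H; lia). ring. }
  induction n as [|n IH]; intros Hi H.
  - rewrite csum_0. f_equal; lia.
  - rewrite csum_S. destruct (Nat.eq_dec i (S n)) as [-> | Hne].
    + rewrite Hz by (intros; apply H; lia). ring.
    + rewrite IH by (intros; try apply H; lia). rewrite (H (S n)) by lia. ring.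
Qed.

Lemma csum_const (c : C) (n : nat) : csum (fun _ => c) n = (INR (S n) * c)%C.
Proof.
  induction n as [|n IH].
  - rewrite csum_0. simpl. ring.
  - rewrite csum_S, IH, (S_INR (S n)), RtoC_plus. ring.
Qed.

Lemma csum_geom (q : C) (n : nat) :
  (csum (fun k => q ^ k)%C n * (q - 1))%C = (q ^ (S n) - 1)%C.
Proof.
  induction n as [|n IH].
  - rewrite csum_0. simpl. ring.
  - rewrite csum_S, Cmult_plus_distr_r, IH. rewrite !Cpow_S. ring.
Qed.

(** Order [S N] rather than [N], because [csum _ N] has [S N] terms. *)
Definition primitive_root (N : nat) (w : C) : Prop :=
  Cmod w = 1 /\ (w ^ S N)%C = 1%C /\
  forall k, (0 < k <= N)%nat -> (w ^ k)%C <> 1%C.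

Lemma primitive_root_exists (N : nat) : exists w : C, primitive_root N w.
Proof.
  set (cis := fun x : R => (cos x, sin x) : C).
  assert (Hpow : forall x k, (cis x ^ k)%C = cis (INR k * x)).
  { intros x k. induction k as [|k IH].
    - unfold cis. rewrite Rmult_0_l, cos_0, sin_0. reflexivity.
    - rewrite Cpow_S, IH, S_INR, Rmult_plus_distr_r, Rmult_1_l.
      unfold cis. rewrite cos_plus, sin_plus. unfold Cmult; simpl.
      f_equal; ring. }
  pose proof (lt_0_INR (S N) ltac:(lia)) as HN.
  exists (cis (2 * PI / INR (S N))). split; [| split].
  - generalize (2 * PI / INR (S N)); intros t.
    unfold cis, Cmod; simpl fst; simpl snd.
    rewrite <- sqrt_1. apply f_equal.
    pose proof (sin2_cos2 t) as H. unfold Rsqr in H. lra.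
  - rewrite Hpow. replace (INR (S N) * (2 * PI / INR (S N))) with (2 * PI) by (field; lra).
    unfold cis. rewrite cos_2PI, sin_2PI. reflexivity.
  - intros k Hk. rewrite Hpow. unfold cis. intros H.
    apply (f_equal fst) in H. change (cos (INR k * (2 * PI / INR (S N))) = 1) in H.
    set (x := INR k * PI / INR (S N)).
    replace (INR k * (2 * PI / INR (S N))) with (2 * x) in H by (unfold x; field; lra).
    rewrite cos_2a_sin in H.
    pose proof PI_RGT_0 as HPI.
    assert (Hx : 0 < sin x).
    { pose proof (lt_0_INR k ltac:(lia)). pose proof (lt_INR k (S N) ltac:(lia)).
      apply sin_gt_0; unfold x.
      - apply Rdiv_lt_0_compat; [apply Rmult_lt_0_compat |]; lra.
      - apply Rlt_div_l; [lra |]. rewrite Rmult_comm. apply Rmult_lt_compat_l; lra. }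
    assert (0 < sin x * sin x) by (apply Rmult_lt_0_compat; lra).
    lra.
Qed.

Lemma primitive_root_sum (N k : nat) (w : C) :
  primitive_root N w -> (k <= N)%nat ->
  csum (fun j => (w ^ j) ^ k)%C N = if Nat.eq_dec k 0 then INR (S N) else 0%C.
Proof.
  intros [_ [Hone Hne]] Hk.
  rewrite (csum_ext _ (fun j => (w ^ k) ^ j)%C)
    by (intros; rewrite <- !Cpow_mult_r; f_equal; lia).
  destruct (Nat.eq_dec k 0) as [-> | Hk0].
  - rewrite (csum_ext _ (fun _ => 1%C)) by (intros; apply Cpow_1_l).
    rewrite csum_const. ring.
  - pose proof (csum_geom (w ^ k)%C N) as Hg.
    rewrite <- Cpow_mult_r, Nat.mul_comm, Cpow_mult_r, Hone, Cpow_1_l in Hg.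
    destruct (Ceq_dec (csum (fun j => (w ^ k) ^ j)%C N) 0) as [H|H]; [exact H |].
    exfalso. apply (Hne k ltac:(lia)).
    assert (Hz : (w ^ k - 1)%C = 0%C).
    { apply (f_equal (fun t => t / csum (fun j => (w ^ k) ^ j) N)%C) in Hg.
      replace (w ^ k - 1)%C
        with (csum (fun j => (w ^ k) ^ j) N * (w ^ k - 1) / csum (fun j => (w ^ k) ^ j) N)%C
        by (field; auto).
      rewrite Hg. field; auto. }
    replace (w ^ k)%C with (w ^ k - 1 + 1)%C by ring. rewrite Hz. ring.
Qed.

Lemma csum_prod (A B : nat -> nat -> C) (M N : nat) :
  csum (fun j => csum (fun k => A k j) M * csum (fun l => B l j) M)%C N =
  csum (fun k => csum (fun l => csum (fun j => A k j * B l j)%C N) M) M.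
Proof.
  rewrite (csum_ext _ (fun j => csum (fun k => csum (fun l => A k j * B l j) M) M)%C).
  2: { intros j _. rewrite csum_mult_r. apply csum_ext; intros k _. apply csum_mult_l. }
  rewrite csum_swap. apply csum_ext; intros k _. apply csum_swap.
Qed.

Definition cpoly (x : nat -> C) (M : nat) (z : C) : C := csum (fun k => x k * z ^ k)%C M.

Lemma Cconj_R (x : R) : Cconj x = x.
Proof. unfold Cconj; simpl. rewrite Ropp_0. reflexivity. Qed.

Lemma Cconj_unit (z : C) : Cmod z = 1 -> (z * Cconj z)%C = 1%C.
Proof. intros H. rewrite <- Cmod2_conj, H. f_equal. ring. Qed.

(** With [X], [Y] the two polynomials, the product
    [2 * Re (X v) * Re (Y (Cconj v))] equals
    [Re (X v * Y (Cconj v) + X v * Cconj (Y (Cconj v)))]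
    and is nonnegative on the circle.  Averaged over sufficiently many roots of
    unity, the first summand leaves the diagonal [x k * y k], because
    [Cconj v] is [/ v], and the second one only the constant terms, because it
    contains nonnegative powers of [v] alone. *)
Lemma cpoly_positive_product (x y : nat -> C) (M : nat) :
  (forall z, Cmod z = 1 -> 0 <= Re (cpoly x M z)) ->
  (forall z, Cmod z = 1 -> 0 <= Re (cpoly y M z)) ->
  0 <= Re (csum (fun k => x k * y k)%C M + x 0%nat * Cconj (y 0%nat)).
Proof.
  intros Hx Hy. set (N := (2 * M)%nat).
  (* Exponents up to [2 * M] occur in the second summand and must not alias to [0]. *)
  destruct (primitive_root_exists N) as [w Hw].
  assert (Hmod : forall j, Cmod (w ^ j)%C = 1).
  { intros j. rewrite Cmod_pow, (proj1 Hw). apply pow1. }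
  set (X := fun j => cpoly x M (w ^ j)%C).
  set (Y := fun j => cpoly y M (Cconj (w ^ j))).
  assert (H1 : csum (fun j => X j * Y j)%C N = (INR (S N) * csum (fun k => x k * y k) M)%C).
  { unfold X, Y, cpoly. rewrite csum_prod, csum_mult_l. apply csum_ext; intros k Hk.
    assert (Hkl : forall l, (l <= M)%nat ->
      csum (fun j => x k * (w ^ j) ^ k * (y l * Cconj (w ^ j) ^ l))%C N
      = if Nat.eq_dec l k then (INR (S N) * (x k * y k))%C else 0%C).
    { intros l Hl.
      destruct (Nat.lt_trichotomy k l) as [Hlt | [-> | Hlt]].
      - destruct (Nat.eq_dec l k) as [|_]; [lia |].
        pose proof (primitive_root_sum N (l - k) w Hw ltac:(lia)) as Hs.
        destruct (Nat.eq_dec (l - k) 0) as [|_]; [lia |].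
        rewrite (csum_ext _ (fun j => x k * y l * Cconj ((w ^ j) ^ (l - k)))%C).
        + rewrite <- csum_mult_l, <- Cconj_csum, Hs.
          rewrite (Cconj_R 0). ring.
        + intros j _. replace l with (k + (l - k))%nat at 2 by lia.
          rewrite Cpow_add_r.
          transitivity (x k * y l * ((w ^ j * Cconj (w ^ j)) ^ k * Cconj (w ^ j) ^ (l - k)))%C.
          { rewrite Cpow_mult_l. ring. }
          rewrite Cconj_unit by apply Hmod. rewrite Cpow_1_l, !Cpow_conj. ring.
      - destruct (Nat.eq_dec l l) as [_|]; [| lia].
        rewrite (csum_ext _ (fun j => x l * y l)%C).
        + apply csum_const.
        + intros j _.
          transitivity (x l * y l * (w ^ j * Cconj (w ^ j)) ^ l)%C.
          { rewrite Cpow_mult_l. ring. }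
          rewrite Cconj_unit by apply Hmod. rewrite Cpow_1_l. ring.
      - destruct (Nat.eq_dec l k) as [|_]; [lia |].
        pose proof (primitive_root_sum N (k - l) w Hw ltac:(lia)) as Hs.
        destruct (Nat.eq_dec (k - l) 0) as [|_]; [lia |].
        rewrite (csum_ext _ (fun j => x k * y l * ((w ^ j) ^ (k - l)))%C).
        + rewrite <- csum_mult_l, Hs. ring.
        + intros j _. replace k with (l + (k - l))%nat at 2 by lia.
          rewrite Cpow_add_r.
          transitivity (x k * y l * ((w ^ j * Cconj (w ^ j)) ^ l * (w ^ j) ^ (k - l)))%C.
          { rewrite Cpow_mult_l. ring. }
          rewrite Cconj_unit by apply Hmod. rewrite Cpow_1_l. ring. }
    rewrite (csum_single _ M k Hk).
    - rewrite Hkl by exact Hk. destruct (Nat.eq_dec k k); [reflexivity | lia].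
    - intros l Hl Hlk. rewrite Hkl by exact Hl. destruct (Nat.eq_dec l k); [lia | reflexivity]. }
  assert (H2 : csum (fun j => X j * Cconj (Y j))%C N
               = (INR (S N) * (x 0%nat * Cconj (y 0%nat)))%C).
  { unfold X, Y, cpoly.
    rewrite (csum_ext _ (fun j => csum (fun k => x k * (w ^ j) ^ k) M
                                 * csum (fun l => Cconj (y l) * (w ^ j) ^ l) M)%C).
    2: { intros j _. f_equal. rewrite Cconj_csum. apply csum_ext; intros l _.
         rewrite Cmult_conj, Cpow_conj, Cconj_conj. reflexivity. }
    rewrite csum_prod.
    assert (Hkl : forall k l, (k <= M)%nat -> (l <= M)%nat ->
      csum (fun j => x k * (w ^ j) ^ k * (Cconj (y l) * (w ^ j) ^ l))%C N
      = if Nat.eq_dec (k + l) 0 then (INR (S N) * (x k * Cconj (y l)))%C else 0%C).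
    { intros k l Hk Hl.
      rewrite (csum_ext _ (fun j => x k * Cconj (y l) * (w ^ j) ^ (k + l))%C)
        by (intros; rewrite Cpow_add_r; ring).
      rewrite <- csum_mult_l, (primitive_root_sum N (k + l) w Hw) by lia.
      destruct (Nat.eq_dec (k + l) 0); ring. }
    rewrite (csum_single _ M 0%nat ltac:(lia)).
    - rewrite (csum_single _ M 0%nat ltac:(lia)).
      + rewrite Hkl by lia. reflexivity.
      + intros l Hl Hl0. rewrite Hkl by lia.
        destruct (Nat.eq_dec (0 + l) 0); [lia | reflexivity].
    - intros k Hk Hk0. rewrite (csum_single _ M 0%nat ltac:(lia)).
      + rewrite Hkl by lia. destruct (Nat.eq_dec (k + 0) 0); [lia | reflexivity].
      + intros l Hl Hl0. rewrite Hkl by lia.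
        destruct (Nat.eq_dec (k + l) 0); [lia | reflexivity]. }
  pose proof (lt_0_INR (S N) ltac:(lia)) as HN.
  apply (Rmult_le_reg_l (INR (S N))); [exact HN |]. rewrite Rmult_0_r.
  rewrite <- re_scal_l, Cmult_plus_distr_l, <- H1, <- H2, re_plus, !Re_csum.
  rewrite <- (sum_n_plus (G := R_AbelianMonoid)).
  rewrite <- (Rmult_0_r (INR (S N))), <- (sum_n_const N 0).
  apply sum_n_m_le; intros j.
  change (0 <= Re (X j * Y j) + Re (X j * Cconj (Y j))).
  rewrite !re_mult, re_conj, im_conj.
  replace (Re (X j) * Re (Y j) - Im (X j) * Im (Y j)
           + (Re (X j) * Re (Y j) - Im (X j) * - Im (Y j)))
    with (2 * (Re (X j) * Re (Y j))) by ring.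
  assert (0 <= Re (X j) * Re (Y j)); [| lra].
  apply Rmult_le_pos; [apply Hx, Hmod | apply Hy].
  rewrite Cmod_conj. apply Hmod.
Qed.

(** * Positivity for absolutely convergent series *)

Definition is_Cseries (a : nat -> C) (l : C) : Prop :=
  @is_series C_AbsRing C_NormedModule a l.

Lemma is_Cseries_eps (a : nat -> C) (l : C) :
  is_Cseries a l <->
  forall eps : posreal, exists N, forall n, (N <= n)%nat -> Cmod (csum a n - l) < eps.
Proof.
  exact (filterlim_locally_ball_norm (K := C_AbsRing) (U := C_NormedModule)
           (F := eventually) (csum a) l).
Qed.

Lemma is_Cseries_ext (a b : nat -> C) (l : C) :
  (forall k, a k = b k) -> is_Cseries a l -> is_Cseries b l.
Proof. exact (is_series_ext (K := C_AbsRing) (V := C_NormedModule) a b l). Qed.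

Lemma is_Cseries_plus (a b : nat -> C) (la lb : C) :
  is_Cseries a la -> is_Cseries b lb ->
  is_Cseries (fun k => a k + b k)%C (la + lb)%C.
Proof. exact (is_series_plus (K := C_AbsRing) (V := C_NormedModule) a b la lb). Qed.

Lemma is_Cseries_minus (a b : nat -> C) (la lb : C) :
  is_Cseries a la -> is_Cseries b lb ->
  is_Cseries (fun k => a k - b k)%C (la - lb)%C.
Proof. exact (is_series_minus (K := C_AbsRing) (V := C_NormedModule) a b la lb). Qed.

Lemma is_Cseries_scal (c : C) (a : nat -> C) (l : C) :
  is_Cseries a l -> is_Cseries (fun k => c * a k)%C (c * l)%C.
Proof. exact (is_series_scal (K := C_AbsRing) (V := C_NormedModule) c a l). Qed.

Lemma is_Cseries_unique (a : nat -> C) (l l' : C) :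
  is_Cseries a l -> is_Cseries a l' -> l = l'.
Proof.
  exact (filterlim_locally_unique (K := C_AbsRing) (V := C_NormedModule)
           (F := eventually) (csum a) l l').
Qed.

Lemma is_Cseries_first (c : C) :
  is_Cseries (fun k => if Nat.eq_dec k 0 then c else 0%C) c.
Proof.
  apply is_Cseries_eps; intros eps. exists 0%nat; intros n _.
  rewrite (csum_single _ n 0%nat ltac:(lia)).
  - simpl. replace (c - c)%C with (RtoC 0) by ring. rewrite Cmod_0. apply cond_pos.
  - intros k _ Hk. destruct (Nat.eq_dec k 0); [contradiction | reflexivity].
Qed.

(** A partial sum differs from the sum by at most the tail of the series of moduli;
    after multiplication by [z ^ k] the bound is uniform in [z] on the unit circle. *)
Lemma is_Cseries_tail (a : nat -> C) (l : C) (L : R) (M : nat) :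
  is_Cseries a l -> is_series (fun k => Cmod (a k)) L ->
  Cmod (l - csum a M) <= L - sum_n (fun k => Cmod (a k)) M.
Proof.
  intros Ha HL. apply le_epsilon; intros eps Heps.
  destruct (proj1 (is_Cseries_eps a l) Ha (mkposreal _ Heps)) as [N HN]; simpl in HN.
  set (n := max N (S M)).
  specialize (HN n ltac:(lia)).
  replace (l - csum a M)%C with (csum a n - csum a M - (csum a n - l))%C by ring.
  eapply Rle_trans; [apply Cmod_triangle |]. rewrite Cmod_opp.
  assert (H1 : Cmod (csum a n - csum a M)
               <= sum_n (fun k => Cmod (a k)) n - sum_n (fun k => Cmod (a k)) M).
  { pose proof (norm_sum_n_m (K := C_AbsRing) (V := C_NormedModule) a (S M) n) as H.
    pose proof (sum_n_m_sum_n (G := C_AbelianGroup) a M n ltac:(lia)) as H1.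
    pose proof (sum_n_m_sum_n (G := R_AbelianGroup) (fun k => Cmod (a k)) M n ltac:(lia)) as H2.
    change (Cmod (minus (csum a n) (csum a M))
            <= minus (sum_n (fun k => Cmod (a k)) n) (sum_n (fun k => Cmod (a k)) M)).
    refine (eq_ind _ (fun t => t <= _) (eq_ind _ (fun t => _ <= t) H _ H2) _ _).
    apply (f_equal Cmod). exact H1. }
  assert (H2 : sum_n (fun k => Cmod (a k)) n <= L).
  { apply (is_lim_seq_incr_compare (sum_n (fun k => Cmod (a k)))).
    - exact HL.
    - intros k. rewrite sum_Sn. unfold plus; simpl. pose proof (Cmod_ge_0 (a (S k))). lra. }
  lra.
Qed.

Lemma cpoly_positive_up_to_tail (x : nat -> C) (X : C -> C) (L : R) (M : nat) :
  is_series (fun k => Cmod (x k)) L ->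
  (forall z, Cmod z = 1 -> is_Cseries (fun k => x k * z ^ k)%C (X z) /\ 0 <= Re (X z)) ->
  forall z, Cmod z = 1 ->
  0 <= Re (cpoly x M z) + (L - sum_n (fun k => Cmod (x k)) M).
Proof.
  intros HL HX z Hz. destruct (HX z Hz) as [Hs Hp].
  assert (Hmod : forall k, Cmod (x k * z ^ k) = Cmod (x k)).
  { intros k. rewrite Cmod_mult, Cmod_pow, Hz, pow1. ring. }
  assert (HL' : is_series (fun k => Cmod (x k * z ^ k)) L)
    by (apply is_series_ext with (2 := HL); intros k; symmetry; apply Hmod).
  pose proof (is_Cseries_tail _ _ _ M Hs HL') as H.
  cbv beta in H. rewrite (sum_n_ext _ _ M Hmod) in H.
  fold (cpoly x M z) in H.
  pose proof (Rle_trans _ _ _ (Rle_abs _) (re_le_Cmod (X z - cpoly x M z))) as H1.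
  unfold Cminus in H1 at 1. rewrite re_plus, re_opp in H1. lra.
Qed.

(** Adding a real constant to the polynomial with coefficients [x]: it
    lifts a truncated series, which may dip below [0] by its tail, back to a
    nonnegative real part. *)
Definition add_to_first (x : nat -> C) (T : R) (k : nat) : C :=
  if Nat.eq_dec k 0 then (x k + T)%C else x k.

Lemma cpoly_add_to_first (x : nat -> C) (T : R) (M : nat) (z : C) :
  cpoly (add_to_first x T) M z = (cpoly x M z + T)%C.
Proof.
  unfold cpoly. induction M as [|M IH].
  - rewrite !csum_0. unfold add_to_first; simpl. ring.
  - rewrite !csum_S, IH. unfold add_to_first; simpl. ring.
Qed.

Lemma csum_add_to_first (x y : nat -> C) (T U : R) (M : nat) :
  csum (fun k => add_to_first x T k * add_to_first y U k)%C M =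
  (csum (fun k => x k * y k)%C M + (T * y 0%nat + U * x 0%nat + T * U))%C.
Proof.
  induction M as [|M IH].
  - rewrite !csum_0. unfold add_to_first; simpl. ring.
  - rewrite !csum_S, IH. unfold add_to_first; simpl. ring.
Qed.

Lemma tail_tends_to_0 (u : nat -> R) (L : R) :
  is_series u L -> is_lim_seq (fun M => L - sum_n u M) 0.
Proof.
  intros H. replace 0 with (L - L) by ring.
  apply is_lim_seq_minus'; [apply is_lim_seq_const | exact H].
Qed.

Lemma is_lim_seq_Re_csum (a : nat -> C) (l : C) :
  is_Cseries a l -> is_lim_seq (fun M => Re (csum a M)) (Re l).
Proof.
  intros Ha. apply is_lim_seq_spec; intros eps.
  destruct (proj1 (is_Cseries_eps a l) Ha eps) as [N HN].
  exists N; intros n Hn.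
  eapply Rle_lt_trans; [| exact (HN n Hn)].
  replace (Re (csum a n) - Re l) with (Re (csum a n - l))
    by (unfold Cminus; rewrite re_plus, re_opp; ring).
  apply re_le_Cmod.
Qed.

(** The polynomial case applied to the truncations, each lifted by its tail; the
    lifts disappear in the limit. *)
Lemma series_positive_product (x y : nat -> C) (X Y : C -> C) (s : C) :
  ex_series (fun k => Cmod (x k)) -> ex_series (fun k => Cmod (y k)) ->
  (forall z, Cmod z = 1 -> is_Cseries (fun k => x k * z ^ k)%C (X z) /\ 0 <= Re (X z)) ->
  (forall z, Cmod z = 1 -> is_Cseries (fun k => y k * z ^ k)%C (Y z) /\ 0 <= Re (Y z)) ->
  is_Cseries (fun k => x k * y k)%C s ->
  0 <= Re (s + x 0%nat * Cconj (y 0%nat)).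
Proof.
  intros [Lx HLx] [Ly HLy] HX HY Hs.
  set (T := fun M => Lx - sum_n (fun k => Cmod (x k)) M).
  set (U := fun M => Ly - sum_n (fun k => Cmod (y k)) M).
  assert (Hpos : forall M, 0 <=
    Re (csum (fun k => x k * y k)%C M) + Re (x 0%nat * Cconj (y 0%nat))
    + (T M * (2 * Re (y 0%nat)) + U M * (2 * Re (x 0%nat)) + T M * (2 * U M))).
  { intros M.
    pose proof (cpoly_positive_product (add_to_first x (T M)) (add_to_first y (U M)) M) as H.
    rewrite csum_add_to_first in H. unfold add_to_first at 3 4 in H.
    eapply Rle_trans.
    - apply H; intros z Hz; rewrite cpoly_add_to_first, re_plus.
      + exact (cpoly_positive_up_to_tail x X Lx M HLx HX z Hz).
      + exact (cpoly_positive_up_to_tail y Y Ly M HLy HY z Hz).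
    - right. simpl Nat.eq_dec. cbv iota.
      generalize (csum (fun k => x k * y k)%C M) (T M) (U M) (x 0%nat) (y 0%nat).
      intros [c1 c2] t u [a1 a2] [b1 b2]. simpl. ring. }
  replace (Re (s + x 0%nat * Cconj (y 0%nat)))
    with (Re s + Re (x 0%nat * Cconj (y 0%nat))
          + (0 * (2 * Re (y 0%nat)) + 0 * (2 * Re (x 0%nat)) + 0 * (2 * 0)))
    by (rewrite re_plus; ring).
  pose proof (tail_tends_to_0 _ _ HLx) as HT. fold T in HT.
  pose proof (tail_tends_to_0 _ _ HLy) as HU. fold U in HU.
  match goal with |- 0 <= ?l =>
    apply (is_lim_seq_le (fun _ => 0) _ (Finite 0) (Finite l) Hpos (is_lim_seq_const 0)) end.
  repeat apply is_lim_seq_plus';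
    repeat first [ apply is_lim_seq_mult' | apply is_lim_seq_const | exact HT | exact HU
                 | apply is_lim_seq_Re_csum, Hs ].
Qed.

(** * The Poisson kernel and Harnack's inequality *)

Lemma one_minus_nonzero (u : C) : Cmod u < 1 -> (1 - u)%C <> 0%C.
Proof.
  intros Hu H. replace u with (1 - (1 - u))%C in Hu by ring. rewrite H in Hu.
  replace (1 - 0)%C with (RtoC 1) in Hu by ring. rewrite Cmod_1 in Hu. lra.
Qed.

Lemma is_Cseries_geom (u : C) :
  Cmod u < 1 -> is_Cseries (fun k => u ^ k)%C (/ (1 - u))%C.
Proof.
  intros Hu.
  pose proof (one_minus_nonzero u Hu) as H1u.
  pose proof (proj1 (Cmod_gt_0 _) H1u) as Hm.
  apply is_Cseries_eps; intros eps.
  assert (Hlim : is_lim_seq (fun n => Cmod u ^ n) 0).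
  { apply is_lim_seq_geom. rewrite Rabs_pos_eq; [exact Hu | apply Cmod_ge_0]. }
  assert (He : 0 < eps * Cmod (1 - u)) by (apply Rmult_lt_0_compat; [apply cond_pos | exact Hm]).
  destruct (proj2 (is_lim_seq_spec _ _) Hlim (mkposreal _ He)) as [N HN]; simpl in HN.
  exists N; intros n Hn.
  assert (Hs : csum (fun k => u ^ k)%C n = ((1 - u ^ S n) / (1 - u))%C).
  { pose proof (csum_geom u n) as Hg.
    replace (csum (fun k => u ^ k)%C n)
      with (- (csum (fun k => u ^ k) n * (u - 1)) / (1 - u))%C by (field; exact H1u).
    rewrite Hg. field; exact H1u. }
  rewrite Hs.
  replace ((1 - u ^ S n) / (1 - u) - / (1 - u))%C with (- (u ^ S n / (1 - u)))%C
    by (field; exact H1u).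
  rewrite Cmod_opp, Cmod_div, Cmod_pow by exact H1u.
  apply Rlt_div_l; [exact Hm |].
  specialize (HN (S n) ltac:(lia)).
  rewrite Rminus_0_r in HN. eapply Rle_lt_trans; [apply Rle_abs | exact HN].
Qed.

(** Coefficients of [(1 + u) / (1 - u)], whose real part is the Poisson kernel. *)
Definition caratheodory_coef (k : nat) : R := if Nat.eq_dec k 0 then 1 else 2.

Lemma is_Cseries_caratheodory (c : nat -> C) (l : C) :
  is_Cseries c l ->
  is_Cseries (fun k => caratheodory_coef k * c k)%C (2 * l - c 0%nat)%C.
Proof.
  intros H.
  apply is_Cseries_ext
    with (fun k => 2 * c k - (if Nat.eq_dec k 0 then c 0%nat else 0%C))%C.
  - intros k. unfold caratheodory_coef.
    destruct (Nat.eq_dec k 0) as [-> |]; [ring | ring].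
  - apply is_Cseries_minus; [apply is_Cseries_scal, H | apply is_Cseries_first].
Qed.

Definition caratheodory (u : C) : C := ((1 + u) / (1 - u))%C.

Lemma is_Cseries_caratheodory_kernel (u : C) :
  Cmod u < 1 -> is_Cseries (fun k => caratheodory_coef k * u ^ k)%C (caratheodory u).
Proof.
  intros Hu. replace (caratheodory u) with (2 * / (1 - u) - u ^ 0)%C.
  - apply is_Cseries_caratheodory with (c := fun k => (u ^ k)%C), is_Cseries_geom, Hu.
  - unfold caratheodory; simpl. field. apply one_minus_nonzero, Hu.
Qed.

Lemma Re_caratheodory (u : C) :
  Cmod u < 1 -> Re (caratheodory u) = (1 - Cmod u ^ 2) / Cmod (1 - u) ^ 2.
Proof.
  intros Hu. pose proof (one_minus_nonzero u Hu) as H0.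
  pose proof (proj1 (Cmod_gt_0 _) H0) as Hm.
  assert (Hm2 : 0 < Cmod (1 - u) ^ 2) by (apply pow_lt, Hm).
  rewrite !Cmod2_alt in *. unfold caratheodory.
  destruct u as [a b]. simpl in *. field.
  simpl in Hm2. lra.
Qed.

Lemma is_Cseries_bounded_terms (a : nat -> C) (l : C) :
  is_Cseries a l -> exists M, 0 <= M /\ forall k, Cmod (a k) <= M.
Proof.
  intros H.
  destruct (filterlim_bounded (K := C_AbsRing) (V := C_NormedModule) (csum a)) as [M HM].
  { exists l. exact H. }
  assert (HM' : forall n, Cmod (csum a n) <= M) by exact HM.
  assert (H0 : 0 <= M) by (eapply Rle_trans; [apply Cmod_ge_0 | apply (HM' 0%nat)]).
  exists (2 * M). split; [lra |]. intros [|k].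
  - rewrite <- csum_0. specialize (HM' 0%nat). lra.
  - replace (a (S k)) with (csum a (S k) - csum a k)%C by (rewrite csum_S; ring).
    eapply Rle_trans; [apply Cmod_triangle |]. rewrite Cmod_opp.
    pose proof (HM' (S k)). pose proof (HM' k). lra.
Qed.

Lemma ex_series_Cmod_inside (a : nat -> C) (x y l : C) :
  Cmod y < Cmod x -> is_Cseries (fun k => a k * x ^ k)%C l ->
  ex_series (fun k => Cmod (a k * y ^ k)).
Proof.
  intros Hxy H. destruct (is_Cseries_bounded_terms _ _ H) as [M [HM0 HM]].
  pose proof (Cmod_ge_0 y) as Hy.
  set (q := Cmod y / Cmod x).
  assert (Hq : 0 <= q < 1).
  { unfold q; split; [apply Rdiv_le_0_compat; lra | apply Rlt_div_l; lra]. }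
  apply (ex_series_le (K := R_AbsRing) (V := R_CompleteNormedModule) _ (fun k => M * q ^ k)).
  - intros k. unfold norm; simpl. unfold abs; simpl.
    rewrite Rabs_pos_eq by apply Cmod_ge_0.
    specialize (HM k). rewrite !Cmod_mult, !Cmod_pow in *.
    replace (Cmod y) with (Cmod x * q) by (unfold q; field; lra).
    rewrite Rpow_mult_distr, <- Rmult_assoc.
    apply Rmult_le_compat_r; [apply pow_le; lra | exact HM].
  - apply (ex_series_scal (K := R_AbsRing) (V := R_NormedModule) M).
    apply ex_series_geom. rewrite Rabs_pos_eq; lra.
Qed.

(** The origin is left out because the functions to which this applies are
    given by formulas that divide by a power of [x]; all the points at
    which they are evaluated are nonzero. *)
Definition has_expansion_off_0 (a : nat -> C) (g : C -> C) : Prop :=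
  forall x : C, x <> 0%C -> Cmod x < 1 -> is_Cseries (fun k => a k * x ^ k)%C (g x).

(** The Hadamard product of the series of [g] with that of [(1 + u) / (1 - u)] gives
    [2 * g - a 0] again, so the positivity of products, applied to [g] on the
    circle of radius [s] and to a combination of kernels, compares values of [g] at
    interior points.  Any inequality between the kernels at [u] and [t * u] is
    thereby inherited by every [g] with nonnegative real part. *)
Lemma poisson_comparison (a : nat -> C) (g : C -> C) (s t A B : R) (z : C) :
  has_expansion_off_0 a g ->
  0 < Cmod z < s -> s < 1 -> 0 < t <= 1 ->
  (forall x, Cmod x = s -> 0 <= Re (g x)) ->
  (forall u, Cmod u = Cmod z / s ->
     0 <= A * Re (caratheodory u) - B * Re (caratheodory (t * u))) ->
  0 <= A * Re (g z) - B * Re (g (t * z)%C).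
Proof.
  intros Hg Hz Hs Ht Hpos Hker.
  assert (Hs0 : 0 < s) by lra.
  assert (HsC : RtoC s <> 0%C) by (intros H; apply RtoC_inj in H; lra).
  set (u0 := (z / s)%C).
  assert (Hu0 : Cmod u0 = Cmod z / s).
  { unfold u0. rewrite Cmod_div, Cmod_R, Rabs_pos_eq by (exact HsC || lra). reflexivity. }
  assert (Hu1 : 0 < Cmod u0 < 1).
  { rewrite Hu0; split; [apply Rdiv_lt_0_compat; lra | apply Rlt_div_l; lra]. }
  assert (Hnz : forall x : C, 0 < Cmod x -> x <> 0%C) by (intros x Hx; apply Cmod_gt_0, Hx).
  assert (Htz : Cmod (t * z) = t * Cmod z)
    by (rewrite Cmod_mult, Cmod_R, Rabs_pos_eq; lra).
  assert (Htz0 : 0 < t * Cmod z <= Cmod z).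
  { split; [apply Rmult_lt_0_compat; lra |].
    rewrite <- (Rmult_1_l (Cmod z)) at 2. apply Rmult_le_compat_r; lra. }
  set (x := fun k => (a k * s ^ k)%C).
  set (y := fun k => ((A - B * t ^ k) * (caratheodory_coef k * u0 ^ k))%C).
  assert (Hu : forall v, Cmod v = 1 -> Cmod (u0 * v) = Cmod u0 /\ Cmod (t * (u0 * v)) < 1).
  { intros v Hv. rewrite !Cmod_mult, Hv, Cmod_R, Rabs_pos_eq, Rmult_1_r by lra.
    split; [reflexivity |].
    apply Rle_lt_trans with (1 * Cmod u0); [apply Rmult_le_compat_r |]; lra. }
  pose proof (series_positive_product x y (fun v => g (s * v)%C)
    (fun v => A * caratheodory (u0 * v) - B * caratheodory (t * (u0 * v)))%C
    (A * (2 * g z - a 0%nat) - B * (2 * g (t * z)%C - a 0%nat))%C) as H.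
  replace (A * Re (g z) - B * Re (g (t * z)%C))
    with (/ 2 * Re (A * (2 * g z - a 0%nat) - B * (2 * g (t * z)%C - a 0%nat)
           + x 0%nat * Cconj (y 0%nat))).
  2: { unfold x, y, caratheodory_coef; simpl.
       destruct (g z) as [g1 g2], (g (t * z)%C) as [h1 h2], (a 0%nat) as [a1 a2].
       simpl. field. }
  apply Rmult_le_pos; [lra |]. apply H; clear H.
  (* Convergence at a radius beyond [s] gives absolute convergence at [s]. *)
  - set (r := (1 + s) / 2).
    assert (Hr : Cmod r = r) by (rewrite Cmod_R; apply Rabs_pos_eq; unfold r; lra).
    eapply ex_series_Cmod_inside with (x := RtoC r);
      [| apply Hg; [apply Hnz; rewrite Hr; unfold r; lra |
                    rewrite Hr; unfold r; lra]].
    rewrite Hr, Cmod_R, Rabs_pos_eq; unfold r; lra.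
  - apply (ex_series_le (K := R_AbsRing) (V := R_CompleteNormedModule) _
             (fun k => (2 * (Rabs A + Rabs B)) * Cmod u0 ^ k)).
    + intros k. unfold norm; simpl. unfold abs; simpl.
      rewrite Rabs_pos_eq by apply Cmod_ge_0. unfold y.
      rewrite !Cmod_mult, Cmod_pow, <- Rmult_assoc.
      apply Rmult_le_compat_r; [apply pow_le; lra |].
      rewrite (Rmult_comm 2).
      apply Rmult_le_compat; try apply Cmod_ge_0.
      * eapply Rle_trans; [apply Cmod_triangle |].
        rewrite Cmod_opp, Cmod_mult, Cmod_pow, !Cmod_R, (Rabs_pos_eq t) by lra.
        apply Rplus_le_compat_l. rewrite <- (Rmult_1_r (Rabs B)) at 2.
        apply Rmult_le_compat_l; [apply Rabs_pos |].
        rewrite <- (pow1 k). apply pow_incr; lra.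
      * rewrite Cmod_R, Rabs_pos_eq; unfold caratheodory_coef; destruct (Nat.eq_dec k 0); lra.
    + apply (ex_series_scal (K := R_AbsRing) (V := R_NormedModule)).
      apply ex_series_geom. rewrite Rabs_pos_eq; lra.
  - intros v Hv.
    assert (Hsv : Cmod (s * v) = s) by (rewrite Cmod_mult, Hv, Cmod_R, Rabs_pos_eq; lra).
    split; [| apply Hpos, Hsv].
    apply is_Cseries_ext with (fun k => a k * (s * v) ^ k)%C.
    + intros k; unfold x. rewrite Cpow_mult_l. ring.
    + apply Hg; [apply Hnz |]; lra.
  - intros v Hv. destruct (Hu v Hv) as [Hv1 Hv2]. split.
    + apply is_Cseries_ext
        with (fun k => A * (caratheodory_coef k * (u0 * v) ^ k)
                       - B * (caratheodory_coef k * (t * (u0 * v)) ^ k))%C.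
      * intros k; unfold y. rewrite !Cpow_mult_l. ring.
      * apply is_Cseries_minus; apply is_Cseries_scal, is_Cseries_caratheodory_kernel;
          [rewrite Hv1; lra | exact Hv2].
    + replace (Re (A * caratheodory (u0 * v) - B * caratheodory (t * (u0 * v))))
        with (A * Re (caratheodory (u0 * v)) - B * Re (caratheodory (t * (u0 * v)))).
      * apply Hker. rewrite Hv1. exact Hu0.
      * unfold Cminus. rewrite re_plus, re_opp, !re_scal_l. reflexivity.
  - assert (Hz' : (s * u0)%C = z) by (unfold u0; field; exact HsC).
    apply is_Cseries_ext
      with (fun k => A * (caratheodory_coef k * (a k * z ^ k))
                     - B * (caratheodory_coef k * (a k * (t * z) ^ k)))%C.
    + intros k; unfold x, y. rewrite <- Hz', !Cpow_mult_l. ring.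
    + replace (a 0%nat) with (a 0%nat * z ^ 0)%C at 1 by (simpl; ring).
      replace (a 0%nat) with (a 0%nat * (t * z) ^ 0)%C at 2 by (simpl; ring).
      apply is_Cseries_minus; apply is_Cseries_scal.
      * apply is_Cseries_caratheodory with (c := fun k => (a k * z ^ k)%C).
        apply Hg; [apply Hnz |]; lra.
      * apply is_Cseries_caratheodory with (c := fun k => (a k * (t * z) ^ k)%C).
        apply Hg; [apply Hnz |]; lra.
Qed.

Lemma nonneg_inside (a : nat -> C) (g : C -> C) (s : R) (z : C) :
  has_expansion_off_0 a g -> 0 < Cmod z < s -> s < 1 ->
  (forall x, Cmod x = s -> 0 <= Re (g x)) -> 0 <= Re (g z).
Proof.
  intros Hg Hz Hs Hpos.
  assert (Hz1 : Cmod z / s < 1) by (apply Rlt_div_l; lra).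
  pose proof (poisson_comparison a g s 1 1 0 z Hg Hz Hs ltac:(lra) Hpos) as H.
  rewrite Rmult_1_l, Rmult_0_l, Rminus_0_r in H. apply H.
  intros u Hu. rewrite Re_caratheodory by lra.
  assert (0 <= (1 - Cmod u ^ 2) / Cmod (1 - u) ^ 2); [| lra].
  apply Rdiv_le_0_compat.
  - pose proof (Cmod_ge_0 u). nra.
  - apply pow_lt, Cmod_gt_0, one_minus_nonzero. lra.
Qed.

(** Multiplied by [(1 + t * r) / (1 - t * r)], the Poisson kernel at [t * u] becomes
    [(1 + t * r) ^ 2 / Cmod (1 - t * u) ^ 2].  The cross difference of
    two such values is [2 * (1 - t) * (1 - t * r ^ 2) * (Re u + r)]. *)
Lemma radial_kernel_monotone (t : R) (u : C) :
  0 < t <= 1 -> Cmod u < 1 ->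
  (1 + t * Cmod u) / (1 - t * Cmod u) * Re (caratheodory (t * u))
  <= (1 + Cmod u) / (1 - Cmod u) * Re (caratheodory u).
Proof.
  intros Ht Hu. pose proof (Cmod_ge_0 u) as H0.
  set (r := Cmod u) in *.
  assert (Htr : t * r <= r) by nra.
  assert (Htu : Cmod (t * u) = t * r)
    by (rewrite Cmod_mult, Cmod_R, Rabs_pos_eq by lra; reflexivity).
  assert (Htr0 : 0 <= t * r) by (apply Rmult_le_pos; lra).
  rewrite !Re_caratheodory by (fold r; lra).
  assert (P1 : 0 < Cmod (1 - u) ^ 2)
    by (apply pow_lt, Cmod_gt_0, one_minus_nonzero; fold r; lra).
  assert (P2 : 0 < Cmod (1 - t * u) ^ 2)
    by (apply pow_lt, Cmod_gt_0, one_minus_nonzero; lra).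
  rewrite Htu; fold r.
  replace ((1 + t * r) / (1 - t * r) * ((1 - (t * r) ^ 2) / Cmod (1 - t * u) ^ 2))
    with ((1 + t * r) ^ 2 / Cmod (1 - t * u) ^ 2) by (field; split; nra).
  replace ((1 + r) / (1 - r) * ((1 - r ^ 2) / Cmod (1 - u) ^ 2))
    with ((1 + r) ^ 2 / Cmod (1 - u) ^ 2) by (field; split; nra).
  apply Rle_div_l; [exact P2 |].
  replace ((1 + r) ^ 2 / Cmod (1 - u) ^ 2 * Cmod (1 - t * u) ^ 2)
    with ((1 + r) ^ 2 * Cmod (1 - t * u) ^ 2 / Cmod (1 - u) ^ 2) by (field; nra).
  apply (proj1 (Rle_div_r _ _ _ P1)).
  assert (Hr2 : r ^ 2 = Re u ^ 2 + Im u ^ 2) by (unfold r; apply Cmod2_alt).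
  assert (Hre : - r <= Re u) 
    by (pose proof (re_le_Cmod u) as H; apply Rabs_le_between in H; fold r in H; lra).
  assert (E1 : Cmod (1 - u) ^ 2 = 1 - 2 * Re u + r ^ 2).
  { rewrite Hr2, Cmod2_alt. destruct u as [p q]; simpl. ring. }
  assert (E2 : Cmod (1 - t * u) ^ 2 = 1 - 2 * t * Re u + t ^ 2 * r ^ 2).
  { rewrite Hr2, Cmod2_alt. destruct u as [p q]; simpl. ring. }
  rewrite E1, E2.
  assert (0 <= 2 * (1 - t) * (1 - t * r * r) * (Re u + r)).
  { repeat apply Rmult_le_pos; nra. }
  nra.
Qed.

Lemma derivative_at_left_maximum (f : R -> R) (l : R) :
  (forall t, 0 < t < 1 -> f t <= f 1) -> is_derive f 1 l -> 0 <= l.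
Proof.
  intros Hmax Hd. apply is_derive_Reals in Hd.
  destruct (Rle_lt_dec 0 l) as [H|H]; [exact H | exfalso].
  destruct (Hd (- l) ltac:(lra)) as [d Hdelta].
  pose proof (cond_pos d) as Hd0.
  set (h := Rmin (d / 2) (1 / 2)).
  assert (Hh : 0 < h) by (apply Rmin_pos; lra).
  pose proof (Rmin_l (d / 2) (1 / 2) : h <= _). pose proof (Rmin_r (d / 2) (1 / 2) : h <= _).
  specialize (Hdelta (- h) ltac:(lra)).
  rewrite Rabs_Ropp, Rabs_pos_eq in Hdelta by lra.
  specialize (Hdelta ltac:(lra)).
  specialize (Hmax (1 + - h) ltac:(lra)).
  apply Rabs_def2 in Hdelta as [Hdelta _].
  assert (0 <= (f (1 + - h) - f 1) / - h).
  { replace ((f (1 + - h) - f 1) / - h) with ((f 1 - f (1 + - h)) / h) by (field; lra).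
    apply Rdiv_le_0_compat; lra. }
  lra.
Qed.

(** By the comparison of kernels, [(1 + t * r) / (1 - t * r) * Re (g (t * z))] is at
    most its value at [t = 1]; the claim is that its derivative there is
    nonnegative. *)
Lemma harnack_derivative (a : nat -> C) (g : C -> C) (s : R) (z l : C) :
  has_expansion_off_0 a g -> 0 < Cmod z < s -> s < 1 ->
  (forall x, Cmod x = s -> 0 <= Re (g x)) ->
  is_Cderive g z l ->
  0 <= Re (z * l) + 2 * (Cmod z / s) / (1 - (Cmod z / s) ^ 2) * Re (g z).
Proof.
  intros Hg Hz Hs Hpos Hl.
  set (r := Cmod z / s).
  assert (Hr : 0 < r < 1) by (unfold r; split; [apply Rdiv_lt_0_compat | apply Rlt_div_l]; lra).
  set (f := fun t : R => (1 + t * r) / (1 - t * r) * Re (g (t * z)%C)).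
  assert (Hd : is_derive f 1
    (2 * r / (1 - r) ^ 2 * Re (g z) + (1 + r) / (1 - r) * Re (z * l))).
  { unfold f.
    evar_last.
    - apply (is_derive_mult (K := R_AbsRing)
               (fun t => (1 + t * r) / (1 - t * r)) (fun t => Re (g (t * z)%C)) 1
               (2 * r / (1 - r) ^ 2)).
      + auto_derive; [lra |]. field. lra.
      + apply is_derive_Re_ray; [apply Cmod_gt_0; lra | exact Hl].
      + exact Rmult_comm.
    - unfold plus, mult; simpl. rewrite Cmult_1_l, Rmult_1_l. reflexivity. }
  apply derivative_at_left_maximum in Hd.
  - replace (Re (z * l) + 2 * r / (1 - r ^ 2) * Re (g z))
      with ((1 - r) / (1 + r) *
            (2 * r / (1 - r) ^ 2 * Re (g z) + (1 + r) / (1 - r) * Re (z * l)))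
      by (field; nra).
    apply Rmult_le_pos; [apply Rdiv_le_0_compat; lra | exact Hd].
  - intros t Ht. unfold f. rewrite Cmult_1_l, Rmult_1_l.
    apply Rminus_le_0.
    apply poisson_comparison with (a := a) (s := s); try assumption; [lra |].
    intros u Hu. pose proof (radial_kernel_monotone t u ltac:(lra)) as H.
    rewrite Hu in H. fold r in H. specialize (H ltac:(lra)). lra.
Qed.

(** * Functions agreeing with 1 up to order n *)

(** Write [w] for [a * x ^ n].  Where [Cmod w] is [1], so that [/ w] is [Cconj w], the
    real part is [Re (p x) * (2 - 2 * Re w)], that is
    [Re (p x) * Cmod (1 - w) ^ 2].  Thus [Re p] is multiplied by a nonnegative
    trigonometric weight with double zeros at the [n] points where [w] is [1],
    and when [p - 1] vanishes to order [n] the product is still the real part of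
    an analytic function. *)
Definition twist (n : nat) (a : C) (p : C -> C) (x : C) : C :=
  (2 * p x - a * x ^ n * (p x + 1) - (p x - 1) / (a * x ^ n))%C.

Lemma is_pseries_is_Cseries (a : nat -> C) (x l : C) :
  @is_pseries C_AbsRing C_NormedModule a x l <-> is_Cseries (fun k => a k * x ^ k)%C l.
Proof.
  split; apply is_Cseries_ext; intros k; apply Cmult_comm.
Qed.

(** The only negative powers come from [(p - 1) / x ^ n], and they cancel because the
    coefficients of [p - 1] below [n] vanish. *)
Lemma twist_expansion (n : nat) (a : C) (p : C -> C) (c : nat -> C) :
  (1 <= n)%nat -> a <> 0%C -> has_expansion p c -> c 0%nat = 1%C ->
  (forall k, (1 <= k < n)%nat -> c k = 0%C) ->
  exists b, has_expansion_off_0 b (twist n a p).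
Proof.
  intros Hn Ha Hp Hc0 Hck.
  set (c1 := fun k => (c k + (if Nat.eq_dec k 0 then 1 else 0))%C).
  set (up := @PS_incr_n C_AbsRing C_NormedModule c1 n).
  exists (fun k => 2 * c k - a * up k - / a * c (n + k)%nat)%C.
  intros x Hx0 Hx.
  pose proof (Hp x Hx) as Hs.
  assert (Hxn : (x ^ n)%C <> 0%C) by (apply Cpow_nz, Hx0).
  assert (Hup : is_Cseries (fun k => up k * x ^ k)%C (x ^ n * (p x + 1))%C).
  { apply is_pseries_is_Cseries.
    apply (is_pseries_incr_n (K := C_AbsRing) (V := C_NormedModule) c1 n x (p x + 1)%C).
    apply is_pseries_is_Cseries.
    apply is_Cseries_ext
      with (fun k => c k * x ^ k + (if Nat.eq_dec k 0 then 1 else 0))%C.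
    - intros k; unfold c1. destruct (Nat.eq_dec k 0) as [-> |]; simpl; ring.
    - apply is_Cseries_plus; [apply is_pseries_is_Cseries, Hs | apply is_Cseries_first]. }
  assert (Hdown : is_Cseries (fun k => c (n + k)%nat * x ^ k)%C ((p x - 1) / x ^ n)%C).
  { apply is_pseries_is_Cseries.
    pose proof (is_pseries_decr_n (K := C_AbsRing) (V := C_NormedModule) c n x (/ x)%C (p x)
                  (Cinv_l x Hx0) Hn Hs) as H.
    change (is_pseries (PS_decr_n c n) x
      ((/ x) ^ n * (p x - csum (fun k => x ^ k * c k) (n - 1)))%C) in H.
    rewrite (csum_single _ (n - 1) 0%nat ltac:(lia)) in H.
    - rewrite Hc0, Cpow_inv in H by exact Hx0. simpl in H.
      replace ((p x - 1) / x ^ n)%C with (/ x ^ n * (p x - 1 * 1))%C by (field; exact Hxn).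
      exact H.
    - intros k Hk Hk0. rewrite Hck by lia. ring. }
  unfold twist.
  replace (2 * p x - a * x ^ n * (p x + 1) - (p x - 1) / (a * x ^ n))%C
    with (2 * p x - a * (x ^ n * (p x + 1)) - / a * ((p x - 1) / x ^ n))%C
    by (field; auto).
  apply is_Cseries_ext
    with (fun k => 2 * (c k * x ^ k) - a * (up k * x ^ k) - / a * (c (n + k)%nat * x ^ k))%C;
    [intros k; ring |].
  repeat apply is_Cseries_minus; apply is_Cseries_scal; try assumption.
  apply is_pseries_is_Cseries, Hs.
Qed.

Lemma Re_twist_on_unit (n : nat) (a : C) (p : C -> C) (x : C) :
  Cmod (a * x ^ n) = 1 ->
  Re (twist n a p x) = Re (p x) * (2 - 2 * Re (a * x ^ n)).
Proof.
  unfold twist. generalize (a * x ^ n)%C (p x). intros w P Hw.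
  assert (Hw0 : w <> 0%C) by (apply Cmod_gt_0; lra).
  assert (Hinv : (/ w)%C = Cconj w).
  { rewrite <- (Cmult_1_l (/ w)), <- (Cconj_unit w Hw). field; exact Hw0. }
  unfold Cdiv. rewrite Hinv.
  destruct w as [w1 w2], P as [P1 P2]. simpl. ring.
Qed.

Lemma Re_twist_nonneg (n : nat) (a : C) (p : C -> C) (x : C) :
  Cmod (a * x ^ n) = 1 -> 0 <= Re (p x) -> 0 <= Re (twist n a p x).
Proof.
  intros Hw Hp. rewrite Re_twist_on_unit by exact Hw.
  pose proof (re_le_Cmod (a * x ^ n)) as H. rewrite Hw in H. apply Rabs_le_between in H.
  apply Rmult_le_pos; lra.
Qed.

Lemma is_Cderive_twist (n : nat) (a : C) (p : C -> C) (z p' : C) :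
  (1 <= n)%nat -> a <> 0%C -> z <> 0%C -> is_Cderive p z p' ->
  exists l, is_Cderive (twist n a p) z l /\
    let w := (a * z ^ n)%C in
    (z * l)%C = (- (z * p') * (1 - w) ^ 2 / w
                 + INR n * ((p z - 1) / w - w * (p z + 1)))%C.
Proof.
  intros Hn Ha Hz Hp.
  assert (Hzn : (z ^ n)%C <> 0%C) by (apply Cpow_nz, Hz).
  assert (Hw : (a * z ^ n)%C <> 0%C) by (apply Cmult_neq_0; auto).
  assert (Hzp : (z * z ^ (n - 1))%C = (z ^ n)%C).
  { rewrite <- Cpow_S. f_equal; lia. }
  pose proof (is_Cderive_mult _ _ z _ _ (is_Cderive_const a z) (is_Cderive_pow n z)) as Dw.
  cbv beta in Dw.
  pose proof (is_Cderive_mult _ _ z _ _ (is_Cderive_const 2 z) Hp) as D1.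
  pose proof (is_Cderive_mult _ _ z _ _ Dw
    (is_Cderive_plus _ _ z _ _ Hp (is_Cderive_const 1 z))) as D2.
  pose proof (is_Cderive_div _ _ z _ _ Hw
    (is_Cderive_minus _ _ z _ _ Hp (is_Cderive_const 1 z)) Dw) as D3.
  eexists; split.
  - exact (is_Cderive_minus _ _ z _ _ (is_Cderive_minus _ _ z _ _ D1 D2) D3).
  - cbv beta zeta. rewrite <- Hzp in *. field.
    repeat split; auto; intros H; apply Hzn; rewrite H; ring.
Qed.

(** The factor of the twist is the one for which the terms without [P] and [D]
    combine to a multiple of [Cconj w - w] and so disappear from the real part. *)
Lemma twisted_combination (n : R) (w P D : C) :
  w <> 0%C -> Cmod w < 1 ->
  Re ((- D * (1 - w) ^ 2 / w + n * ((P - 1) / w - w * (P + 1)))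
      + (n * (1 + Cmod w ^ 2) / (1 - Cmod w ^ 2))%R
        * (2 * P - w * (P + 1) - (P - 1) / w))%C
  = 2 * n / (1 - Cmod w ^ 2) * Cmod (1 - w) ^ 2 * Re P - Re (D * (1 - w) ^ 2 / w).
Proof.
  intros Hw Hw1.
  assert (Hd : 0 < 1 - Cmod w ^ 2) by (pose proof (Cmod_ge_0 w); nra).
  (* Writing [Cmod w ^ 2] as [w * Cconj w] makes this an identity of rational
     functions in [w], [Cconj w], [P] and [D]. *)
  set (k := (n / (1 - Cmod w ^ 2))%R).
  replace (n * (1 + Cmod w ^ 2) / (1 - Cmod w ^ 2)) with (k * (1 + Cmod w ^ 2))
    by (unfold k; field; lra).
  replace (RtoC n) with (k * (1 - w * Cconj w))%C.
  2: { rewrite <- Cmod2_conj, <- RtoC_minus, <- RtoC_mult. f_equal. unfold k; field; lra. }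
  rewrite RtoC_mult, RtoC_plus, Cmod2_conj.
  replace (- D * (1 - w) ^ 2 / w
           + k * (1 - w * Cconj w) * ((P - 1) / w - w * (P + 1))
           + k * (1 + w * Cconj w) * (2 * P - w * (P + 1) - (P - 1) / w))%C
    with (k * (2 * ((1 - w) * Cconj (1 - w)) * P + 2 * (Cconj w - w)) - D * (1 - w) ^ 2 / w)%C.
  2: { rewrite Cminus_conj. rewrite (Cconj_R 1).
       field; exact Hw. }
  rewrite <- Cmod2_conj.
  replace (2 * n / (1 - Cmod w ^ 2)) with (2 * k) by (unfold k; field; lra).
  unfold Cminus at 1. rewrite re_plus, re_opp, re_scal_l.
  apply (f_equal2 Rplus); [| reflexivity]. clear.
  generalize (Cmod (1 - w) ^ 2). intros m.
  destruct w as [w1 w2], P as [P1 P2]. simpl. ring.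
Qed.

(** Compares the constant of Harnack's inequality with that of the twisted
    combination.  Dividing by [1 - x ^ 2] turns it into
    [2 * (x + x ^ 3 + ... + x ^ (2 n - 1)) <= n * (1 + x ^ (2 n))]. *)
Lemma even_power_sum_bound (n : nat) (x : R) :
  0 < x < 1 -> (1 <= n)%nat ->
  2 * x / (1 - x ^ 2) <= INR n * (1 + (x ^ n) ^ 2) / (1 - (x ^ n) ^ 2).
Proof.
  intros Hx Hn.
  assert (Hy : 0 < x ^ 2 < 1) by (simpl; nra).
  rewrite <- !pow_mult, (Nat.mul_comm n 2), !pow_mult.
  set (y := x ^ 2) in *.
  assert (Hyn : 0 < y ^ n <= y).
  { split; [apply pow_lt; lra |]. destruct n as [|n]; [lia |].
    simpl. rewrite <- (Rmult_1_r y) at 3. apply Rmult_le_compat_l; [lra |].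
    rewrite <- (pow1 n). apply pow_incr; lra. }
  assert (Hpow : forall m, 0 <= y ^ m <= 1).
  { intros m; split; [apply pow_le; lra |]. rewrite <- (pow1 m). apply pow_incr; lra. }
  assert (H1 : forall m, INR m * y ^ m * (1 - y) <= 1 - y ^ m).
  { induction m as [|m IH]; [simpl; lra |].
    rewrite S_INR. simpl. pose proof (Hpow m). pose proof (pos_INR m).
    assert (y * (INR m * y ^ m * (1 - y)) <= y * (1 - y ^ m)) by (apply Rmult_le_compat_l; lra).
    assert (y * y ^ m * (1 - y) <= 1 * (1 - y)) by (apply Rmult_le_compat_r; nra).
    lra. }
  assert (H2 : forall m, 2 * x * (1 - y ^ m) <= INR m * (1 + y ^ m) * (1 - y)).
  { induction m as [|m IH]; [simpl; lra |].
    rewrite S_INR. simpl. pose proof (Hpow m) as Hm. specialize (H1 m).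
    assert (0 <= (1 - y) * (1 - y ^ m - INR m * y ^ m * (1 - y)))
      by (apply Rmult_le_pos; lra).
    assert (0 <= y ^ m * ((1 - x) * (1 - x)) * (1 - y))
      by (repeat apply Rmult_le_pos; lra || nra).
    replace ((1 - x) * (1 - x)) with (1 + y - 2 * x) in * by (unfold y; ring).
    lra. }
  apply Rle_div_l; [lra |].
  replace (INR n * (1 + y ^ n) / (1 - y ^ n) * (1 - y))
    with (INR n * (1 + y ^ n) * (1 - y) / (1 - y ^ n)) by (field; lra).
  apply (proj1 (Rle_div_r _ _ (1 - y ^ n) ltac:(lra))). apply H2.
Qed.

(** Harnack's inequality for the twist of [p] on the circle of radius [Cmod z / rho].
    The parameter [a] with [a * z ^ n = w] has [Cmod (a * x ^ n) = 1] exactly on that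
    circle, which is where the hypothesis [Cmod w = rho ^ n] enters. *)
Lemma twisted_derivative_bound (n : nat) (p : C -> C) (c : nat -> C) (z p' w : C) (rho : R) :
  (1 <= n)%nat -> has_expansion p c -> c 0%nat = 1%C ->
  (forall k, (1 <= k < n)%nat -> c k = 0%C) ->
  (forall x : C, Defs.disc 1 x -> 0 < Re (p x)) ->
  0 < Cmod z < rho -> rho < 1 -> is_Cderive p z p' ->
  Cmod w = rho ^ n ->
  Re (z * p' * (1 - w) ^ 2 / w)
  <= 2 * INR n / (1 - (rho ^ n) ^ 2) * Cmod (1 - w) ^ 2 * Re (p z).
Proof.
  intros Hn Hp Hc0 Hck Hpos Hz Hrho Hd Hw.
  assert (Hz0 : z <> 0%C) by (apply Cmod_gt_0; lra).
  assert (Hrn : 0 < rho ^ n < 1).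
  { split; [apply pow_lt; lra | apply pow_lt_1_compat; [lra | lia]]. }
  assert (Hw0 : w <> 0%C) by (apply Cmod_gt_0; lra).
  assert (Hzn : (z ^ n)%C <> 0%C) by (apply Cpow_nz, Hz0).
  set (a := (w / z ^ n)%C).
  assert (Ha : a <> 0%C).
  { intros H. apply Hw0. replace w with (a * z ^ n)%C by (unfold a; field; exact Hzn).
    rewrite H. ring. }
  assert (Haz : (a * z ^ n)%C = w) by (unfold a; field; exact Hzn).
  set (s := Cmod z / rho).
  assert (Hs : Cmod z < s < 1).
  { unfold s; split; [apply Rlt_div_r; nra | apply Rlt_div_l; lra]. }
  assert (Hsz : Cmod z / s = rho) by (unfold s; field; lra).
  assert (Hcircle : forall x : C, Cmod x = s -> 0 <= Re (twist n a p x)).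
  { intros x Hx. apply Re_twist_nonneg.
    - unfold a. rewrite Cmod_mult, Cmod_div, !Cmod_pow, Hx, Hw by exact Hzn.
      unfold s. unfold Rdiv at 2. rewrite Rpow_mult_distr, pow_inv.
      field. split; apply pow_nonzero; lra.
    - apply Rlt_le, Hpos. unfold Defs.disc; lra. }
  destruct (twist_expansion n a p c Hn Ha Hp Hc0 Hck) as [b Hb].
  destruct (is_Cderive_twist n a p z p' Hn Ha Hz0 Hd) as [l [Hl Hzl]].
  cbv zeta in Hzl. rewrite Haz in Hzl.
  pose proof (harnack_derivative b _ s z l Hb ltac:(lra) ltac:(lra) Hcircle Hl) as H1.
  pose proof (nonneg_inside b _ s z Hb ltac:(lra) ltac:(lra) Hcircle) as H2.
  rewrite Hsz in H1.
  pose proof (even_power_sum_bound n rho ltac:(lra) Hn) as H3.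
  pose proof (twisted_combination (INR n) w (p z) (z * p') Hw0 ltac:(lra)) as H4.
  rewrite Hw in H4. rewrite <- Hzl, re_plus, re_scal_l in H4.
  replace (2 * p z - w * (p z + 1) - (p z - 1) / w)%C with (twist n a p z) in H4
    by (unfold twist; rewrite Haz; reflexivity).
  pose proof (Rmult_le_compat_r _ _ _ H2 H3) as H5.
  lra.
Qed.

(** As [w] runs over the circle of radius [rho ^ n], the direction in which the
    preceding bound controls [z * p'] runs over all directions; the choice of [w]
    below makes it that of [/ p z]. *)
Lemma log_derivative_bound (n : nat) (p : C -> C) (c : nat -> C) (z p' : C) (rho : R) :
  (1 <= n)%nat -> has_expansion p c -> c 0%nat = 1%C ->
  (forall k, (1 <= k < n)%nat -> c k = 0%C) ->
  (forall x : C, Defs.disc 1 x -> 0 < Re (p x)) ->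
  0 < Cmod z < rho -> rho < 1 -> is_Cderive p z p' ->
  Re (z * p' / p z) <= 2 * INR n * rho ^ n / (1 - (rho ^ n) ^ 2).
Proof.
  intros Hn Hp Hc0 Hck Hpos Hz Hrho Hd.
  assert (Hpz : 0 < Re (p z)) by (apply Hpos; unfold Defs.disc; lra).
  pose proof (Rle_trans _ _ _ (Rle_abs _) (re_le_Cmod (p z))) as Hle.
  assert (HP : p z <> 0%C) by (apply Cmod_gt_0; lra).
  set (m := Cmod (p z)) in *.
  assert (Hrn : 0 < rho ^ n < 1).
  { split; [apply pow_lt; lra | apply pow_lt_1_compat; [lra | lia]]. }
  set (r := rho ^ n) in *.
  set (e := (m / p z)%C).
  assert (HmC : RtoC m <> 0%C) by (intros H; apply RtoC_inj in H; lra).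
  assert (Hr1 : Cmod r = r) by (rewrite Cmod_R, Rabs_pos_eq; lra).
  assert (He : Cmod e = 1).
  { unfold e. rewrite Cmod_div, Cmod_R, Rabs_pos_eq by (exact HP || lra).
    fold m. field; lra. }
  assert (He0 : e <> 0%C) by (apply Cmod_gt_0; lra).
  assert (Hsum : forall x y : C, Cmod x <> Cmod y -> (x + y)%C <> 0%C).
  { intros x y Hxy H. apply Hxy. rewrite <- (Cmod_opp y).
    replace x with (x + y - y)%C by ring. rewrite H. f_equal. ring. }
  assert (Her : (e + r)%C <> 0%C) by (apply Hsum; lra).
  assert (Her' : (1 + e * r)%C <> 0%C).
  { apply Hsum. rewrite Cmod_1, Cmod_mult, He, Hr1. lra. }
  assert (HrC : RtoC r <> 0%C) by (apply Cmod_gt_0; lra).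
  (* The solution of [(1 - w) ^ 2 / w = e * Cmod (1 - w) ^ 2 / r]. *)
  set (w := (r * (1 + e * r) / (e + r))%C).
  assert (Hwc : Cconj w = (r * (e + r) / (1 + e * r))%C).
  { assert (Hec : Cconj e = (/ e)%C).
    { rewrite <- (Cmult_1_l (/ e)), <- (Cconj_unit e He). field; exact He0. }
    unfold w. rewrite Cdiv_conj, Cmult_conj, !Cplus_conj, Cmult_conj, Hec by exact Her.
    rewrite (Cconj_R r).
    rewrite (Cconj_R 1).
    field. repeat split; auto. }
  assert (Hw : Cmod w = r).
  { assert (H : Cmod w ^ 2 = r ^ 2).
    { apply RtoC_inj. rewrite Cmod2_conj, Hwc, RtoC_pow. unfold w. simpl. field; auto. }
    pose proof (Cmod_ge_0 w). nra. }
  assert (Hw1 : (1 - w)%C <> 0%C) by (apply one_minus_nonzero; lra).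
  pose proof (proj1 (Cmod_gt_0 _) Hw1) as Hm1.
  pose proof (twisted_derivative_bound n p c z p' w rho Hn Hp Hc0 Hck Hpos Hz Hrho Hd Hw) as H.
  fold r in H.
  assert (Hfac : (z * p' * (1 - w) ^ 2 / w
                 = (Cmod (1 - w) ^ 2 * (m / r))%R * (z * p' / p z))%C).
  { rewrite RtoC_mult, RtoC_div, Cmod2_conj, Cminus_conj, Hwc by lra.
    rewrite (Cconj_R 1).
    replace (p z) with (m / e)%C by (unfold e; field; auto).
    unfold w. field; repeat split; auto. }
  rewrite Hfac, re_scal_l in H.
  set (L := Re (z * p' / p z)) in *.
  assert (Hq : 0 < Cmod (1 - w) ^ 2) by (apply pow_lt, Hm1).
  set (q := Cmod (1 - w) ^ 2) in *.
  assert (Hd1 : 0 < 1 - r ^ 2) by (simpl; nra).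
  set (K := 2 * INR n * r / (1 - r ^ 2)).
  assert (HK : 0 <= K).
  { unfold K. apply Rdiv_le_0_compat; [| exact Hd1].
    pose proof (pos_INR n). repeat apply Rmult_le_pos; lra. }
  replace (2 * INR n / (1 - r ^ 2)) with (K / r) in H by (unfold K; field; lra).
  assert (Hkey : q * (m / r) * L <= q * (m / r) * K).
  { eapply Rle_trans; [exact H |].
    replace (K / r * q * Re (p z)) with (q / r * K * Re (p z)) by (field; lra).
    replace (q * (m / r) * K) with (q / r * K * m) by (field; lra).
    apply Rmult_le_compat_l; [| exact Hle].
    apply Rmult_le_pos; [apply Rdiv_le_0_compat; lra | exact HK]. }
  apply Rmult_le_reg_l with (2 := Hkey).
  apply Rmult_lt_0_compat; [exact Hq | apply Rdiv_lt_0_compat; lra].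
Qed.

(** * The bound on the class *)

Lemma times_quotient_by_z (f : C -> C) (x : C) :
  f 0%C = 0%C -> f x = (x * quotient_by_z f x)%C.
Proof.
  intros H0. unfold quotient_by_z. destruct (Ceq_dec x 0) as [-> | Hx].
  - rewrite H0. ring.
  - field; exact Hx.
Qed.

Lemma class_A_at_0 (n : nat) (f : C -> C) : class_A n f -> f 0%C = 0%C.
Proof.
  intros [_ [a [Ha0 [_ [_ Ha]]]]].
  transitivity (a 0%nat); [| exact Ha0].
  assert (H0 : Defs.disc 1 0) by (unfold Defs.disc; rewrite Cmod_0; lra).
  exact (is_Cseries_unique _ _ _ (Ha _ H0)
           (is_pseries_0 (K := C_AbsRing) (V := C_NormedModule) a)).
Qed.

Lemma z_log_derivative_product (f p : C -> C) (z p' : C) :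
  (forall x : C, f x = (x * p x)%C) -> z <> 0%C -> p z <> 0%C -> is_Cderive p z p' ->
  z_log_derivative f z = (1 + z * p' / p z)%C.
Proof.
  intros Hf Hz Hpz Hd. unfold z_log_derivative.
  destruct (Ceq_dec z 0) as [|_]; [contradiction |].
  rewrite (is_C_derive_unique f z (1 * p z + z * p')%C).
  - rewrite Hf. field; auto.
  - apply (is_derive_ext (fun x => x * p x)%C); [intros x; symmetry; apply Hf |].
    exact (is_Cderive_mult _ p z _ _ (is_Cderive_id z) Hd).
Qed.

Lemma pow_strict_mono (n : nat) (x y : R) :
  (1 <= n)%nat -> 0 <= x < y -> x ^ n < y ^ n.
Proof.
  intros Hn Hxy. induction n as [|n IH]; [lia |].
  destruct n as [|n]; [simpl; lra |].
  specialize (IH ltac:(lia)).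
  change (x * x ^ S n < y * y ^ S n).
  apply Rmult_le_0_lt_compat; try lra. apply pow_le; lra.
Qed.

Lemma class_S_M_condition (n : nat) (f : C -> C) (beta rho r : R) :
  (1 <= n)%nat -> 1 < beta -> class_S n f -> 0 < rho <= 1 ->
  (forall x, 0 < x < rho -> 2 * INR n * x ^ n / (1 - (x ^ n) ^ 2) < beta - 1) ->
  r < rho -> M_condition beta r f.
Proof.
  intros Hn Hbeta [HA [Hana [[c [Hc0 [Hck Hp]]] Hpos]]] Hrho Hbound Hr z Hz.
  unfold Defs.disc in Hz.
  pose proof (fun x => times_quotient_by_z f x (class_A_at_0 n f HA)) as Hf.
  set (p := quotient_by_z f) in *.
  assert (Hpz : p z <> 0%C).
  { intros H. specialize (Hpos z ltac:(unfold Defs.disc; lra)).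
    rewrite H in Hpos. simpl in Hpos. lra. }
  split; [intros Hz0; rewrite Hf; apply Cmult_neq_0; assumption |].
  destruct (Ceq_dec z 0) as [Hz0 | Hz0].
  { unfold z_log_derivative. destruct (Ceq_dec z 0); [simpl; lra | contradiction]. }
  destruct (Hana z ltac:(unfold Defs.disc; lra)) as [p' Hd].
  rewrite (z_log_derivative_product f p z p' Hf Hz0 Hpz Hd).
  pose proof (proj1 (Cmod_gt_0 z) Hz0) as Hm.
  pose proof (log_derivative_bound n p c z p' ((Cmod z + rho) / 2) Hn Hp Hc0 Hck Hpos
                ltac:(lra) ltac:(lra) Hd) as H.
  specialize (Hbound ((Cmod z + rho) / 2) ltac:(lra)).
  rewrite re_plus, re_RtoC. lra.
Qed.

(** * The extremal function *)

(** The sum [L] exists by comparison and is found from [L = 1 + z ^ n * L], which holds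
    because the coefficients are periodic. *)
Lemma is_Cseries_sparse_geom (n : nat) (z : C) :
  (1 <= n)%nat -> Cmod z < 1 ->
  is_Cseries (fun k => (if Nat.eq_dec (k mod n) 0 then 1 else 0) * z ^ k)%C (/ (1 - z ^ n))%C.
Proof.
  intros Hn Hz. set (e := fun k : nat => ((if Nat.eq_dec (k mod n) 0 then 1 else 0) * z ^ k)%C).
  pose proof (Cmod_ge_0 z) as H0.
  destruct (ex_series_le (K := C_AbsRing) (V := C_CompleteNormedModule) e (fun k => Cmod z ^ k))
    as [L0 HL].
  - intros k. change (Cmod (e k) <= Cmod z ^ k). unfold e.
    rewrite Cmod_mult, Cmod_pow. pose proof (pow_le _ k H0).
    destruct (Nat.eq_dec (k mod n) 0); rewrite ?Cmod_1, ?Cmod_0; lra.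
  - apply ex_series_geom. rewrite Rabs_pos_eq; lra.
  - set (L := L0 : C). change (is_Cseries e L) in HL.
    assert (Hzn : Cmod (z ^ n) < 1) by (rewrite Cmod_pow; apply pow_lt_1_compat; [lra | lia]).
    pose proof (one_minus_nonzero _ Hzn) as Hne.
    assert (H1 : csum e (pred n) = 1%C).
    { rewrite (csum_single e (pred n) 0%nat ltac:(lia)).
      - unfold e. rewrite Nat.Div0.mod_0_l. simpl. ring.
      - intros k Hk Hk0. unfold e. rewrite Nat.mod_small by lia.
        destruct (Nat.eq_dec k 0); [contradiction | ring]. }
    assert (H2 : is_Cseries (fun k => e (n + k)%nat) (L - 1)%C).
    { apply (is_series_incr_n (K := C_AbsRing) (V := C_NormedModule) e n (L - 1)%C ltac:(lia)).
      change (is_Cseries e (L - 1 + csum e (pred n))%C). rewrite H1.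
      replace (L - 1 + 1)%C with L by ring. exact HL. }
    assert (H3 : is_Cseries (fun k => e (n + k)%nat) (z ^ n * L)%C).
    { apply is_Cseries_ext with (fun k => z ^ n * e k)%C; [| apply is_Cseries_scal, HL].
      intros k; unfold e. rewrite Cpow_add_r.
      replace (n + k)%nat with (k + 1 * n)%nat by lia. rewrite Nat.Div0.mod_add. ring. }
    pose proof (is_Cseries_unique _ _ _ H2 H3) as H.
    replace (/ (1 - z ^ n))%C with L; [exact HL |].
    transitivity ((L - z ^ n * L) / (1 - z ^ n))%C; [field; exact Hne |].
    rewrite <- H. field; exact Hne.
Qed.

(** The Poisson measure of this [p] is carried by the [n]-th roots of unity.  At a
    point of the positive real axis the twist used in the upper bound has [a > 0],
    and its weight vanishes at these roots as the circle grows to the unit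
    circle, so that nothing is lost in the limit. *)
Definition extremal_p (n : nat) (z : C) : C := caratheodory (z ^ n).
Definition extremal_f (n : nat) (z : C) : C := (z * extremal_p n z)%C.
Definition extremal_coef (n k : nat) : C :=
  (caratheodory_coef k * (if Nat.eq_dec (k mod n) 0 then 1 else 0))%C.

Lemma extremal_p_expansion (n : nat) :
  (1 <= n)%nat -> has_expansion (extremal_p n) (extremal_coef n).
Proof.
  intros Hn z Hz. unfold Defs.disc in Hz. apply is_pseries_is_Cseries.
  assert (Hzn : Cmod (z ^ n) < 1)
    by (rewrite Cmod_pow; apply pow_lt_1_compat; [split; [apply Cmod_ge_0 | exact Hz] | lia]).
  pose proof (is_Cseries_caratheodory _ _ (is_Cseries_sparse_geom n z Hn Hz)) as H.
  cbv beta in H. rewrite Nat.Div0.mod_0_l in H. simpl Nat.eq_dec in H. cbv iota in H.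
  replace (extremal_p n z) with (2 * / (1 - z ^ n) - 1 * z ^ 0)%C.
  - revert H. apply is_Cseries_ext. intros k. unfold extremal_coef. ring.
  - unfold extremal_p, caratheodory. simpl. field. apply one_minus_nonzero, Hzn.
Qed.

Lemma is_Cderive_extremal_p (n : nat) (z : C) :
  (1 <= n)%nat -> Cmod z < 1 ->
  is_Cderive (extremal_p n) z (2 / (1 - z ^ n) ^ 2 * (INR n * z ^ (n - 1)))%C.
Proof.
  intros Hn Hz.
  assert (Hzn : (1 - z ^ n)%C <> 0%C).
  { apply one_minus_nonzero. rewrite Cmod_pow.
    apply pow_lt_1_compat; [split; [apply Cmod_ge_0 | exact Hz] | lia]. }
  apply (is_Cderive_comp caratheodory (fun x => x ^ n)%C); [| apply is_Cderive_pow].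
  replace (2 / (1 - z ^ n) ^ 2)%C
    with (((0 + 1) * (1 - z ^ n) - (1 + z ^ n) * (0 - 1)) / ((1 - z ^ n) * (1 - z ^ n)))%C
    by (simpl; field; exact Hzn).
  apply (is_Cderive_div (fun u => 1 + u)%C (fun u => 1 - u)%C); [exact Hzn | |].
  - apply (is_Cderive_plus (fun _ => RtoC 1) (fun u => u));
      [apply is_Cderive_const | apply is_Cderive_id].
  - apply (is_Cderive_minus (fun _ => RtoC 1) (fun u => u));
      [apply is_Cderive_const | apply is_Cderive_id].
Qed.

Lemma quotient_extremal_f (n : nat) (z : C) :
  (1 <= n)%nat -> quotient_by_z (extremal_f n) z = extremal_p n z.
Proof.
  intros Hn. unfold quotient_by_z. destruct (Ceq_dec z 0) as [-> | Hz].
  - unfold extremal_p, caratheodory. destruct n as [|n]; [lia |].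
    rewrite Cpow_S, Cmult_0_l. field.
  - unfold extremal_f. field; exact Hz.
Qed.

Lemma extremal_f_class_S (n : nat) : (1 <= n)%nat -> class_S n (extremal_f n).
Proof.
  intros Hn. split; split.
  - intros z Hz. eexists.
    exact (is_Cderive_mult _ _ z _ _ (is_Cderive_id z) (is_Cderive_extremal_p n z Hn Hz)).
  - exists (@PS_incr_1 C_AbsRing C_NormedModule (extremal_coef n)).
    split; [reflexivity | split; [| split]].
    + unfold PS_incr_1, extremal_coef, caratheodory_coef.
      rewrite Nat.Div0.mod_0_l. simpl. ring.
    + intros [|[|k]] Hk; try lia. unfold PS_incr_1, extremal_coef.
      rewrite Nat.mod_small by lia. simpl. ring.
    + intros z Hz.
      exact (is_pseries_incr_1 (K := C_AbsRing) (V := C_NormedModule) _ z _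
               (extremal_p_expansion n Hn z Hz)).
  - intros z Hz. eexists.
    apply (is_derive_ext (extremal_p n)).
    + intros x; symmetry; apply quotient_extremal_f, Hn.
    + exact (is_Cderive_extremal_p n z Hn Hz).
  - split.
    + exists (extremal_coef n). split; [| split].
      * unfold extremal_coef, caratheodory_coef. rewrite Nat.Div0.mod_0_l. simpl. ring.
      * intros k Hk. unfold extremal_coef. rewrite Nat.mod_small by lia.
        destruct (Nat.eq_dec k 0); [lia | ring].
      * intros z Hz. rewrite quotient_extremal_f by exact Hn.
        apply extremal_p_expansion; assumption.
    + intros z Hz. rewrite quotient_extremal_f by exact Hn.
      assert (Hzn : 0 <= Cmod (z ^ n) < 1).
      { split; [apply Cmod_ge_0 |]. rewrite Cmod_pow.
        apply pow_lt_1_compat; [split; [apply Cmod_ge_0 | exact Hz] | lia]. }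
      unfold extremal_p. rewrite Re_caratheodory by lra.
      apply Rdiv_lt_0_compat; [simpl; nra |].
      apply pow_lt, Cmod_gt_0, one_minus_nonzero; lra.
Qed.

Lemma extremal_f_log_derivative (n : nat) (x : R) :
  (1 <= n)%nat -> 0 < x < 1 ->
  Re (z_log_derivative (extremal_f n) x) = 1 + 2 * INR n * x ^ n / (1 - (x ^ n) ^ 2).
Proof.
  intros Hn Hx.
  assert (Hxn : 0 < x ^ n < 1) by (split; [apply pow_lt; lra | apply pow_lt_1_compat; [lra | lia]]).
  assert (HxC : RtoC x <> 0%C) by (intros H; apply RtoC_inj in H; lra).
  assert (Hxp : extremal_p n x = ((1 + x ^ n) / (1 - x ^ n))%R).
  { unfold extremal_p, caratheodory.
    rewrite RtoC_div, RtoC_plus, RtoC_minus, RtoC_pow by lra. reflexivity. }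
  rewrite (z_log_derivative_product (extremal_f n) (extremal_p n) x
             (2 / (1 - x ^ n) ^ 2 * (INR n * x ^ (n - 1)))%C (fun _ => eq_refl) HxC);
    [| rewrite Hxp; intros H; apply RtoC_inj in H;
       pose proof (Rdiv_lt_0_compat (1 + x ^ n) (1 - x ^ n) ltac:(lra) ltac:(lra)); lra
     | apply is_Cderive_extremal_p; [exact Hn | rewrite Cmod_R, Rabs_pos_eq; lra]].
  rewrite Hxp, re_plus, re_RtoC. f_equal.
  replace (x * (2 / (1 - x ^ n) ^ 2 * (INR n * x ^ (n - 1))) / ((1 + x ^ n) / (1 - x ^ n))%R)%C
    with (RtoC (2 * INR n * x ^ n / (1 - (x ^ n) ^ 2))); [apply re_RtoC |].
  replace (x * (2 / (1 - x ^ n) ^ 2 * (INR n * x ^ (n - 1))))%C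
    with (2 / (1 - x ^ n) ^ 2 * INR n * (x * x ^ (n - 1)))%C by ring.
  rewrite <- Cpow_S. replace (S (n - 1)) with n by lia.
  rewrite <- !RtoC_pow.
  rewrite <- RtoC_minus, <- RtoC_pow, <- RtoC_div, <- !RtoC_mult, <- RtoC_div.
  - apply f_equal. field. repeat split; nra.
  - apply Rgt_not_eq, Rdiv_lt_0_compat; lra.
  - apply pow_nonzero; lra.
Qed.

(** * The radius *)

Lemma logder_bound_increasing (k x y : R) :
  0 < k -> 0 <= x < y -> y < 1 -> k * x / (1 - x ^ 2) < k * y / (1 - y ^ 2).
Proof.
  intros Hk Hx Hy.
  apply Rlt_div_l; [simpl; nra |].
  replace (k * y / (1 - y ^ 2) * (1 - x ^ 2)) with (k * y * (1 - x ^ 2) / (1 - y ^ 2))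
    by (field; nra).
  apply (proj1 (Rlt_div_r _ _ (1 - y ^ 2) ltac:(simpl; nra))).
  rewrite !Rmult_assoc. apply Rmult_lt_compat_l; [exact Hk |].
  assert (0 < (y - x) * (1 + x * y)) by (apply Rmult_lt_0_compat; nra).
  simpl; lra.
Qed.

(** The positive root of [d * (1 - t ^ 2) = 2 * m * t], rationalised. *)
Lemma critical_value (m d : R) :
  0 < m -> 0 < d ->
  let t := d / (m + sqrt (m ^ 2 + d ^ 2)) in
  0 < t < 1 /\ 2 * m * t / (1 - t ^ 2) = d.
Proof.
  intros Hm Hd t.
  set (q := sqrt (m ^ 2 + d ^ 2)) in *.
  assert (Hq : q * q = m ^ 2 + d ^ 2) by (apply sqrt_sqrt; simpl; nra).
  assert (Hq0 : 0 <= q) by apply sqrt_pos.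
  assert (Hqd : d < q) by nra.
  assert (Ht : 0 < t < 1).
  { unfold t; split; [apply Rdiv_lt_0_compat; lra | apply Rlt_div_l; lra]. }
  split; [exact Ht |].
  assert (E : d * (1 - t ^ 2) = 2 * m * t).
  { unfold t. apply Rmult_eq_reg_r with ((m + q) ^ 2); [| apply pow_nonzero; lra].
    replace (d * (1 - (d / (m + q)) ^ 2) * (m + q) ^ 2) with (d * ((m + q) ^ 2 - d ^ 2))
      by (field; lra).
    replace (2 * m * (d / (m + q)) * (m + q) ^ 2) with (2 * m * d * (m + q)) by (field; lra).
    simpl in *. nra. }
  rewrite <- E. field. nra.
Qed.

Theorem theorem3p1 (n : nat) (beta : R) (hn : (1 <= n)%nat) (hbeta : 1 < beta) :
  is_M_radius beta (class_S n)
    (Rpower ((beta - 1) / (INR n + sqrt (INR n ^ 2 + (beta - 1) ^ 2)))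
            (1 / INR n)).
Proof.
  pose proof (lt_0_INR n ltac:(lia)) as Hn0.
  destruct (critical_value (INR n) (beta - 1) Hn0 ltac:(lra)) as [Ht Hcrit].
  set (t := (beta - 1) / (INR n + sqrt (INR n ^ 2 + (beta - 1) ^ 2))) in *.
  set (rho := Rpower t (1 / INR n)).
  assert (Hrho0 : 0 < rho) by apply exp_pos.
  assert (Hrhon : rho ^ n = t).
  { unfold rho. rewrite <- Rpower_pow by apply exp_pos. rewrite Rpower_mult.
    replace (1 / INR n * INR n) with 1 by (field; lra). apply Rpower_1; lra. }
  assert (Hrho1 : rho < 1).
  { destruct (Rlt_le_dec rho 1) as [H|H]; [exact H |].
    pose proof (pow_R1_Rle rho n H). lra. }
  split.
  - split; [lra |]. intros f Hf r Hr.
    apply class_S_M_condition with (n := n) (rho := rho); try assumption; [lra |].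
    intros x Hx.
    apply Rlt_le_trans with (2 * INR n * t / (1 - t ^ 2)); [| lra].
    assert (Hxt : x ^ n < t) by (rewrite <- Hrhon; apply pow_strict_mono; [exact hn | lra]).
    apply logder_bound_increasing; [lra | | lra].
    split; [apply pow_le; lra | exact Hxt].
  - intros rho' [Hrho' Hcond].
    destruct (Rle_lt_dec rho' rho) as [H|H]; [exact H | exfalso].
    (* At the point [rho] the extremal function takes the excluded value [beta]. *)
    assert (Hdisc : Defs.disc ((rho + rho') / 2) rho)
      by (unfold Defs.disc; rewrite Cmod_R, Rabs_pos_eq; lra).
    destruct (Hcond _ (extremal_f_class_S n hn) ((rho + rho') / 2) ltac:(lra) _ Hdisc)
      as [_ Hlt].
    rewrite extremal_f_log_derivative, Hrhon in Hlt by (exact hn || lra).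
    lra.
Qed.
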